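(* Assume $a,b\in C^1(\mathbb{R})$ are globally Lipschitz continuous and $a\ge a_0>0$. Let $u\in K$ satisfy $F(u)=\min_K F$. Then $u\in W^{2,\infty}(0,T)$ and there exists a nonnegative Radon measure $f$ on $[0,T-1]$ with $\operatorname{supp} f\subset\omega_c$ such that $$-2a(u(x))u''(x)-a'(u(x))\,u'(x)^2+b'(u(x))=\int_{x-1}^x f \quad\text{for a.e. } x\in(0,T).$$
   Context: Fix $T>1$. $X=H^1_0(0,T)$, $U=\{1+v:v\in X\}$, $F(u)=\int_0^T[a(u)(u')^2+b(u)]\,dx$, $(Bu)(x)=\int_x^{x+1}u$ for $x\in[0,T-1]$, $K=\{u\in U: Bu\ge0 \text{ on }[0,T-1]\}$. The contact set of $u\in K$ is $\omega_c=\{x\in[0,T-1]: (Bu)(x)=0\}$. A Radon measure $f$ on $[0,T-1]$ is extended by zero outside $[0,T-1]$, and $\int_{x-1}^x f$ denotes $f([x-1,x])$. *)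

(* Defs.v *)
From HB Require Import structures.
From mathcomp Require Import all_boot all_order all_algebra.
From mathcomp Require Import all_classical all_reals all_analysis.
Set Implicit Arguments. Unset Strict Implicit. Unset Printing Implicit Defensive.
Import Order.TTheory GRing.Theory Num.Theory.
Import numFieldNormedType.Exports.
Local Open Scope ring_scope.
Local Open Scope classical_set_scope.

Section Defs.
Context {R : realType}.

Definition lebR := (@lebesgue_measure R).

Definition L2_on (A : set R) (g : R -> R) : Prop :=
  measurable_fun A g /\ (\int[lebR]_(x in A) ((g x) ^+ 2)%:E < +oo)%E.

(* v is (the continuous representative of) an element of H^1_0(0,T):
   v(x) = int_0^x g with g in L^2(0,T), and v(T) = 0 (v(0) = 0 is automatic). *)
Definition H10 (T : R) (v : R -> R) : Prop :=
  exists g : R -> R, L2_on `[0, T] g /\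
    (forall x, `[0, T] x -> v x = Rintegral lebR `[0, x] g) /\ v T = 0.

Definition inU (T : R) (u : R -> R) : Prop := H10 T (fun x => u x - 1).

Definition Bop (u : R -> R) (x : R) : R := Rintegral lebR `[x, x + 1] u.

Definition inK (T : R) (u : R -> R) : Prop :=
  inU T u /\ forall x, `[0, T - 1] x -> 0 <= Bop u x.

Definition contact_set (T : R) (u : R -> R) : set R :=
  [set x | `[0, T - 1] x /\ Bop u x = 0].

Definition Fenergy (a b : R -> R) (T : R) (u : R -> R) : \bar R :=
  \int[lebR]_(x in `[0, T]) (a (u x) * (derive1 u x) ^+ 2 + b (u x))%:E.

Definition C1 (f : R -> R) : Prop :=
  (forall x, derivable f x 1) /\ continuous (derive1 f).

Definition glob_lipschitz (f : R -> R) : Prop :=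
  exists L : R, forall x y, `|f x - f y| <= L * `|x - y|.

(* u in W^{2,infty}(0,T): u is differentiable on (0,T) and u' is Lipschitz
   there (i.e. u' in W^{1,infty}(0,T)). *)
Definition W2inf (T : R) (u : R -> R) : Prop :=
  (forall x, `]0, T[ x -> derivable u x 1) /\
  exists L : R, forall x y, `]0, T[ x -> `]0, T[ y ->
    `|derive1 u x - derive1 u y| <= L * `|x - y|.

Definition msupport (f : {measure set R -> \bar R}) : set R :=
  [set x | forall e : R, 0 < e -> (0 < f (ball x e))%E].

(* a nonnegative Radon measure on [0, T-1], extended by zero outside *)
Definition radon_on_seg (T : R) (f : {measure set R -> \bar R}) : Prop :=
  f (~` `[0, T - 1]) = 0%E /\ (f (`[0%R, (T - 1)%R]%classic) < +oo)%E.

End Defs.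

(* Main.v *)
Require Import Defs.
From HB Require Import structures.
From mathcomp Require Import all_boot all_order all_algebra.
From mathcomp Require Import all_classical all_reals all_analysis.
From mathcomp Require Import measurable_realfun ring lra.
Import Order.TTheory GRing.Theory Num.Theory.
Import numFieldNormedType.Exports.
Local Open Scope ring_scope.
Local Open Scope classical_set_scope.
Set Implicit Arguments. Unset Strict Implicit. Unset Printing Implicit Defensive.

(** Write [Lam v] for the first variation of [F] at [u].  Minimality gives
    [0 <= Lam v] whenever [B v >= 0], so [Lam] factors through [B] as a positive
    linear functional on the range of [B].  This range contains cutoffs between
    the indicators of [[0, i/n]] and [[0, (i+1)/n]]: sum the integer translates of
    a bump supported in [[i/n, (i+1)/n]]; no integer lies strictly inside, so the
    sum vanishes at [0].  These cutoffs suffice for a Riesz representation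
    [Lam v = \int B v df], where [f] is the Stieltjes measure of
    [Phi x = inf {Lam v : B v >= 1_[0, x]}].  Fubini turns this into
    [Lam v = \int v(y) f[y-1, y] dy], and the lemma of du Bois-Reymond makes
    [2 a(u) u'] a.e. equal to a continuous function, which bootstraps to
    [W^{2, oo}] and to the Euler equation.  Finally [\int B u df = 0], since a
    [w] with [B w = 0] makes both [w - u] and [u - w] admissible; hence [f] lives
    on the contact set. *)

(** The functions [B v] are Lipschitz, so they do not fill C([0, T-1]) and Riesz's theorem for
    continuous functions does not apply as it stands. What replaces density is that the range
    contains functions dropping from 1 to 0 within any one grid cell: sums of such cutoffs
    approximate each [B v] uniformly, and positivity bounds the resulting error by a multiple of
    [Phi (T - 1)]. The functional is kept as a relation between a function and a value, and
    positivity itself makes it single-valued. The constant 1 lies in the range on [0, T-1] although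
    v vanishes at both ends: averages over [x, x+1] reach up to T, which leaves the last cutoff a
    full unit of room beyond T-1. Since u' is known only almost everywhere before regularity is
    proved, every element of H^1_0 travels with a chosen density. Variations use the steps 1/(n+1):
    dominated convergence is about sequences, and the direction w - u is certain to be admissible
    only for steps at most 1. The global Lipschitz bounds on a and b supply the dominating
    function. *)

(** * Integrals of functions not assumed measurable, off a null set *)

Section integral_off_null_set.
Local Open Scope ereal_scope.
Context d (T : measurableType d) (R : realType) (mu : {measure set T -> \bar R}).
Import HBNNSimple.

(** A simple function below f, multiplied by the indicator of the complement of N, lies below g
    because g is nonnegative on N, and it keeps its integral. *)
Let sup_simple_le_off_null (N : set T) (f g : T -> \bar R) :
  measurable N -> mu N = 0 -> (forall x, 0 <= g x) ->
  (forall x, ~ N x -> f x = g x) ->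
  ereal_sup [set sintegral mu h |
     h in [set h : {nnsfun T >-> R} | forall x, (h x)%:E <= f x]] <=
  ereal_sup [set sintegral mu h |
     h in [set h : {nnsfun T >-> R} | forall x, (h x)%:E <= g x]].
Proof.
move=> mN N0 g0 fg; apply: ge_ereal_sup => _ [h hf <-].
apply: ereal_sup_ubound; exists (proj_nnsfun h (measurableC mN)).
  move=> x /=;  rewrite measurable_realfun.mindicE; case: (boolP (x \in ~` N)) => [/set_mem xN|_].
    by rewrite mulr1 -fg.
  by rewrite mulr0.
rewrite -!integralT_nnsfun; apply: ge0_ae_eq_integral => //.
- exact/measurable_EFinP.
- exact/measurable_EFinP.
- by move=> x _; rewrite lee_fin; exact: fun_ge0.
- by move=> x _; rewrite lee_fin; exact: fun_ge0.
exists N; split => // x /=; apply: contra_notP => xN _.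
by rewrite measurable_realfun.mindicE mem_set// mulr1.
Qed.

(** Neither function is assumed measurable, so this applies to integrands containing [derive1 u], as
    in [Fenergy]. *)
Lemma integral_eq_off_null (D N : set T) (f g : T -> \bar R) :
  measurable N -> mu N = 0 -> (forall x, D x -> ~ N x -> f x = g x) ->
  \int[mu]_(x in D) f x = \int[mu]_(x in D) g x.
Proof.
move=> mN N0 fg; rewrite /integral.
have fgD x : ~ N x -> (f \_ D) x = (g \_ D) x.
  by move=> xN; rewrite !patchE; case: ifPn => // /set_mem Dx; exact: fg.
by congr (_ - _); apply/eqP; rewrite eq_le; apply/andP; split;
  apply: (sup_simple_le_off_null mN N0) => // x xN; rewrite ?funeposE ?funenegE fgD.
Qed.

End integral_off_null_set.

(** * Square-integrable functions on a set of finite measure *)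

Section square_integrable.
Context d (T : measurableType d) (R : realType) (mu : {measure set T -> \bar R}).
Variables (D : set T) (mD : measurable D) (muD : (mu D < +oo)%E).
Implicit Types f g h : T -> R.

Lemma integrable_le f g : measurable_fun D f ->
  mu.-integrable D (EFin \o g) -> (forall x, D x -> `|f x| <= g x) ->
  mu.-integrable D (EFin \o f).
Proof.
move=> mf ig fg; apply: le_integrable ig => //; first exact/measurable_EFinP.
by move=> x Dx /=; rewrite lee_fin (le_trans (fg _ Dx))// ler_norm.
Qed.

Lemma integrable_realD f g : mu.-integrable D (EFin \o f) ->
  mu.-integrable D (EFin \o g) -> mu.-integrable D (EFin \o (fun x => f x + g x)).
Proof. exact: integrableD. Qed.

Lemma integrable_realB f g : mu.-integrable D (EFin \o f) ->
  mu.-integrable D (EFin \o g) -> mu.-integrable D (EFin \o (fun x => f x - g x)).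
Proof. exact: integrableB. Qed.

Lemma integrable_realZ (k : R) f : mu.-integrable D (EFin \o f) ->
  mu.-integrable D (EFin \o (fun x => k * f x)).
Proof. exact: integrableZl. Qed.

Lemma integrable_cst (k : R) : mu.-integrable D (EFin \o cst k).
Proof.
apply: measurable_bounded_integrable => //.
by exists `|k|; split => // M kM x _; exact: ltW.
Qed.

Lemma integrable_bounded f (M : R) : measurable_fun D f ->
  (forall x, D x -> `|f x| <= M) -> mu.-integrable D (EFin \o f).
Proof. by move=> mf fM; apply: (integrable_le mf (integrable_cst M)). Qed.

Lemma integrable_bounded_mul f h (M : R) : measurable_fun D h ->
  (forall x, D x -> `|h x| <= M) -> mu.-integrable D (EFin \o f) ->
  mu.-integrable D (EFin \o (fun x => h x * f x)).
Proof.
move=> mh hM intf.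
have mf : measurable_fun D f by apply/measurable_EFinP/(measurable_int mu).
apply: (@integrable_le _ (fun x => M * `|f x|)).
- exact: measurable_funM.
- exact: (integrableZl mD _ (integrable_norm intf)).
by move=> x Dx; rewrite normrM ler_wpM2r// hM.
Qed.

Definition square_integrable f :=
  measurable_fun D f /\ mu.-integrable D (EFin \o (fun x => f x ^+ 2)).

Lemma square_integrableM f g : square_integrable f -> square_integrable g ->
  mu.-integrable D (EFin \o (fun x => f x * g x)).
Proof.
move=> [mf if2] [mg ig2].
apply: (integrable_le _ (integrableD mD if2 ig2)); first exact: measurable_funM.
move=> x Dx /=; rewrite normrM -(real_normK (num_real (f x))).
by rewrite -(real_normK (num_real (g x))); nra.
Qed.

Lemma square_integrable_bounded f (M : R) : measurable_fun D f ->
  (forall x, D x -> `|f x| <= M) -> square_integrable f.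
Proof.
move=> mf fM; split => //; apply: (@integrable_bounded _ (M ^+ 2)).
  exact: measurable_funX.
by move=> x Dx; rewrite normrX lerXn2r ?nnegrE// ?fM// (le_trans _ (fM _ Dx)).
Qed.

Lemma square_integrable_int f : square_integrable f ->
  mu.-integrable D (EFin \o f).
Proof.
move=> sf; have sc : square_integrable (cst 1).
  by apply: (@square_integrable_bounded _ 1) => // x _; rewrite normr1.
have := square_integrableM sf sc.
by apply: eq_integrable => // x _ /=; rewrite mulr1.
Qed.

Lemma square_integrableMb f h (M : R) : measurable_fun D h ->
  (forall x, D x -> `|h x| <= M) -> square_integrable f ->
  square_integrable (fun x => h x * f x).
Proof.
move=> mh hM [mf if2]; split; first exact: measurable_funM.
have hM2 x : D x -> `|h x ^+ 2| <= M ^+ 2.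
  by move=> Dx; rewrite normrX lerXn2r ?nnegrE// ?hM// (le_trans _ (hM _ Dx)).
have := integrable_bounded_mul (measurable_funX 2 mh) hM2 if2.
by apply: eq_integrable => // x _ /=; rewrite exprMn.
Qed.

Lemma square_integrableD f g : square_integrable f -> square_integrable g ->
  square_integrable (fun x => f x + g x).
Proof.
move=> [mf if2] [mg ig2]; split; first exact: measurable_funD.
have i2 := integrableZl mD 2 (integrableD mD if2 ig2).
apply: (integrable_le _ i2).
  by apply: measurable_funX; exact: measurable_funD.
move=> x Dx /=; rewrite ger0_norm ?sqr_ge0//.
have := sqr_ge0 (f x - g x). nra.
Qed.

Lemma square_integrableZ (k : R) f : square_integrable f ->
  square_integrable (fun x => k * f x).
Proof. exact: (@square_integrableMb _ (cst k) `|k|). Qed.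

End square_integrable.

(** * Fubini for a product kernel cut off to a planar set *)

Section two_measure_fubini.
Context d1 d2 (T1 : measurableType d1) (T2 : measurableType d2) (R : realType).
Variables (m1 : {sigma_finite_measure set T1 -> \bar R}).
Variables (m2 : {sigma_finite_measure set T2 -> \bar R}).
Variables (A : set T1) (B : set T2) (E : set (T1 * T2)).
Hypotheses (mA : measurable A) (mB : measurable B) (mE : measurable E).

(** The integrand k(x) g(y) 1_E(x, y) is dominated by |k(x)| |g(y)|, hence integrable for the
    product measure. Used with the multiplier against Lebesgue measure on a strip, and with Lebesgue
    measure twice on a triangle. *)
Lemma fubini_section (k : T1 -> R) (g : T2 -> R) :
  m1.-integrable A (EFin \o k) -> m2.-integrable B (EFin \o g) ->
  (\int[m1]_(x in A) (k x * \int[m2]_(y in B `&` xsection E x) g y) =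
   \int[m2]_(y in B) (g y * \int[m1]_(x in A `&` ysection E y) k x)) /\
  m2.-integrable B (EFin \o (fun y => g y * \int[m1]_(x in A `&` ysection E y) k x)).
Proof.
move=> ik ig.
pose k' := k \_ A; pose g' := g \_ B.
have ik' : m1.-integrable setT (EFin \o k').
  by have /integrable_mkcond := ik => /(_ mA); rewrite restrict_EFin.
have ig' : m2.-integrable setT (EFin \o g').
  by have /integrable_mkcond := ig => /(_ mB); rewrite restrict_EFin.
have mk' : measurable_fun setT k' by apply/measurable_EFinP/(measurable_int m1).
have mg' : measurable_fun setT g' by apply/measurable_EFinP/(measurable_int m2).
pose F (z : T1 * T2) := (k' z.1 * g' z.2 * \1_E z)%:E.
have mF : measurable_fun setT F.
  apply/measurable_EFinP; apply: measurable_funM; last exact: measurable_indic.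
  by apply: measurable_funM; exact: measurableT_comp.
have iF : (m1 \x m2)%E.-integrable setT F.
  apply/(integrable12ltyP m1 m2 mF).
  apply: (@le_lt_trans _ _ (\int[m1]_x (`|k' x|%:E * \int[m2]_y `|g' y|%:E))%E).
    apply: ge0_le_integral => //.
    - by move=> x _; exact: integral_ge0.
    - by apply: (measurable_fun_fubini_tonelli_F (abse \o F)) => //=;
        exact: measurableT_comp.
    - apply/emeasurable_funM => //; apply/measurable_EFinP.
      exact: measurableT_comp.
    - move=> x _; rewrite -ge0_integralZl//; last first.
        by apply/measurable_EFinP; exact: measurableT_comp.
      apply: ge0_le_integral => //.
      + by apply: measurableT_comp => //; apply: measurableT_comp mF _.
      + apply/measurable_EFinP; apply: measurable_funM => //.
        exact: measurableT_comp.
      + move=> y _; rewrite /F /= lee_fin !normrM; apply: ler_piMr; first exact: mulr_ge0.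
        by rewrite indicE; case: (_ \in _); rewrite ?normr1 ?normr0.
  have /integrableP[_ ig'oo] := ig'; have /integrableP[_ ik'oo] := ik'.
  rewrite ge0_integralZr//; last exact: integral_ge0.
    apply: lte_mul_pinfty => //; first exact: integral_ge0.
    by rewrite ge0_fin_numE ?integral_ge0.
  by apply/measurable_EFinP; exact: measurableT_comp.
have msec (x : T1) : measurable (B `&` xsection E x).
  by apply: measurableI => //; exact: measurable_xsection.
have msecy (y : T2) : measurable (A `&` ysection E y).
  by apply: measurableI => //; exact: measurable_ysection.
have isec (x : T1) : m2.-integrable (B `&` xsection E x) (EFin \o g).
  exact: integrableS ig.
have isecy (y : T2) : m1.-integrable (A `&` ysection E y) (EFin \o k).
  exact: integrableS ik.
have Hx x : (\int[m2]_y F (x, y) =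
   (k' x * \int[m2]_(y in B `&` xsection E x) g y)%:E)%E.
  rewrite EFinM /Rintegral fineK; last exact: (integrable_fin_num (msec x) (isec x)).
  rewrite -integralZl ?isec//.
  rewrite [RHS]integral_mkcond; apply: eq_integral => y _.
  rewrite /F /= /g' !patchE indicE in_setI mem_xsection.
  by case: (_ \in B); case: (_ \in E); rewrite /= ?mulr1 ?mulr0 ?mul0r// EFinM.
have Hy y : (\int[m1]_x F (x, y) =
   (g' y * \int[m1]_(x in A `&` ysection E y) k x)%:E)%E.
  rewrite EFinM /Rintegral fineK; last exact: (integrable_fin_num (msecy y) (isecy y)).
  rewrite -integralZl ?isecy//.
  rewrite [RHS]integral_mkcond; apply: eq_integral => x _.
  rewrite /F /= /k' !patchE indicE in_setI mem_ysection.
  by case: (_ \in A); case: (_ \in E); rewrite /= ?mulr1 ?mulr0 ?mul0r// -EFinM mulrC.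
have restrM S (p q : S -> R) (C : set S) :
    (fun x => p x * q x) \_ C = (fun x => (p \_ C) x * q x).
  by apply/funext => x; rewrite !patchE; case: ifP => //; rewrite mul0r.
split.
  rewrite Rintegral_mkcond [RHS]Rintegral_mkcond /Rintegral; congr fine.
  rewrite !restrM// -/k' -/g'.
  under eq_integral do rewrite -Hx.
  under [RHS]eq_integral do rewrite -Hy.
  exact: Fubini.
have mG : measurable_fun setT (fun y => g' y * \int[m1]_(x in A `&` ysection E y) k x).
  apply/measurable_EFinP; have := measurable_fubini_G iF; rewrite /fubini_G.
  by under eq_fun do rewrite Hy.
apply/(integrable_mkcond _ mB); rewrite restrict_EFin restrM -/g'.
pose C := \int[m1]_(x in A) `|k x|.
apply: (@integrable_le _ _ _ _ _ measurableT _ (fun y => C * `|g' y|)) => //.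
  exact: (integrableZl measurableT C (integrable_norm ig')).
move=> y _; rewrite normrM mulrC ler_wpM2r//.
apply: le_trans (le_normr_Rintegral (msecy y) (isecy y)) _.
have ink : m1.-integrable A (EFin \o (fun x => `|k x|)) by exact: integrable_norm.
rewrite /C /Rintegral fine_le//.
- by apply: integrable_fin_num => //; apply: integrableS ink.
- exact: integrable_fin_num.
apply: ge0_subset_integral => //.
by apply: (measurable_int m1).
Qed.
End two_measure_fubini.

(** * Continuous functions and primitives on a segment *)

Section segment.
Context (R : realType).
Local Notation mu := (@lebesgue_measure R).

Lemma within_continuous_bounded (a b : R) (f : R -> R) : a <= b ->
  {within `[a, b], continuous f} ->
  exists M, forall x, `[a, b]%classic x -> `|f x| <= M.
Proof.
move=> ab cf.
have cnf : {within `[a, b], continuous (Num.norm \o f)}.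
  by apply: within_continuous_comp => // x _; exact: norm_continuous.
have [c cab cmax] := EVT_max ab cnf.
by exists `|f c| => x /= xab; exact: cmax.
Qed.

Lemma within_continuous_measurable (a b : R) (f : R -> R) :
  {within `[a, b], continuous f} -> measurable_fun `[a, b] f.
Proof. by move=> cf; apply: subspace_continuous_measurable_fun. Qed.

Lemma lebesgue_segment_lty (a b : R) : (mu `[a, b] < +oo)%E.
Proof. by rewrite lebesgue_measure_itv /=; case: ifP => _; rewrite ?ltry. Qed.

Lemma within_continuous_integrable (a b : R) (f : R -> R) :
  {within `[a, b], continuous f} -> mu.-integrable `[a, b] (EFin \o f).
Proof. by move=> cf; apply: continuous_compact_integrable => //; exact: segment_compact. Qed.

Lemma Rintegral_segment_cat (a b c : R) (f : R -> R) : a <= b -> b <= c ->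
  mu.-integrable `[a, c] (EFin \o f) ->
  \int[mu]_(x in `[a, c]) f x =
  \int[mu]_(x in `[a, b]) f x + \int[mu]_(x in `[b, c]) f x.
Proof.
move=> ab bc intf; have := @Rintegral_itvB _ f (BLeft a) (BRight c) b intf.
rewrite !bnd_simp => /(_ ab bc) /eqP; rewrite subr_eq => /eqP ->.
rewrite addrC; congr (_ + _); apply: Rintegral_itv_obnd_cbnd.
by apply: integrableS intf => //; apply: subset_itvr; rewrite bnd_simp.
Qed.

Lemma lipschitz_Rintegral (a b M : R) (f : R -> R) :
  mu.-integrable `[a, b] (EFin \o f) -> (forall x, `[a, b]%classic x -> `|f x| <= M) ->
  forall x y, `[a, b]%classic x -> `[a, b]%classic y ->
  `|\int[mu]_(t in `[a, x]) f t - \int[mu]_(t in `[a, y]) f t| <= M * `|x - y|.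
Proof.
move=> intf fM.
suff H x y : x <= y -> `[a, b]%classic x -> `[a, b]%classic y ->
    `|\int[mu]_(t in `[a, x]) f t - \int[mu]_(t in `[a, y]) f t| <= M * `|x - y|.
  move=> x y xab yab; have [xy|/ltW yx] := leP x y; first exact: H.
  by rewrite distrC (distrC x); exact: H.
rewrite /= !in_itv/= => xy /andP[ax xb] /andP[ay yb].
have sub : `[x, y] `<=` `[a, b].
  by move=> t /=; rewrite !in_itv/= => /andP[xt ty]; rewrite (le_trans ax)//= (le_trans ty).
have intxy : mu.-integrable `[x, y] (EFin \o f) by exact: integrableS intf.
rewrite (Rintegral_segment_cat ax xy); last first.
  by apply: integrableS intf => //; apply: subset_itvl; rewrite bnd_simp.
rewrite opprD addNKr normrN (le_trans (le_normr_Rintegral _ intxy))//.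
have -> : M * `|x - y| = \int[mu]_(t in `[x, y]) M.
  rewrite Rintegral_cst//= lebesgue_measure_itv/= lte_fin.
  case: ltP => [xy'|yx] /=; first by rewrite distrC ger0_norm// subr_ge0.
  by rewrite (_ : x = y) ?subrr ?normr0//; apply/eqP; rewrite eq_le xy.
apply: le_Rintegral => //; first exact: integrable_norm.
- by apply: integrable_cst => //; exact: lebesgue_segment_lty.
- by move=> t xyt; apply/fM/sub.
Qed.

End segment.

(** * Elements of H^1_0(0,T) paired with a density *)

Section sobolev_density.
Context (R : realType) (T : R) (T0 : 0 < T).
Local Notation mu := (@lebesgue_measure R).
Local Notation I := (`[0%R, T]%classic).
Implicit Types v g : R -> R.

Let mI : measurable I. Proof. exact: measurable_itv. Qed.
Let I_lty : (mu I < +oo)%E. Proof. exact: lebesgue_segment_lty. Qed.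

Lemma Rintegral_ae_derive v g : mu.-integrable I (EFin \o g) ->
  (forall x, I x -> v x = \int[mu]_(t in `[0, x]) g t) -> exists N, [/\ measurable N, mu N = 0%E &
  forall x, `]0, T[%classic x -> ~ N x -> is_derive x 1 v (g x)].
Proof.
move=> ig vE.
(* Extension by zero makes the density locally integrable on the whole line, as [FTC1] requires. *)
pose f : R -> R := g \_ I.
pose F (x : R) := \int[mu]_(t in `[0, x]) f t.
have intf : mu.-integrable setT (EFin \o f).
  by have /integrable_mkcond := ig => /(_ mI); rewrite restrict_EFin.
have [||N [mN N0 sN]] := @FTC1 _ f (BLeft 0).
- by move=> y; apply: integrableS intf.
- by apply: open_integrable_locally => //; exact: openT.
exists N; split => // x xT xN.
have [dF Ff] : derivable F x 1 /\ F^`() x = f x.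
  apply: contrapT => H; apply: xN; apply: sN => /=; apply: contra_not H; apply.
  by move: xT; rewrite /= !in_itv/= lte_fin => /andP[].
have fx : f x = g x.
  by rewrite /f patchE mem_set//; move: xT; rewrite /= !in_itv/= => /andP[/ltW -> /ltW ->].
rewrite -fx -Ff derive1E.
apply: near_eq_is_derive (DeriveDef dF erefl).
near=> y; have : `]0, T[%classic y by near: y; exact: near_in_itvoo.
rewrite /= in_itv/= => /andP[y0 yT].
rewrite vE; last by rewrite /= in_itv/= !ltW.
apply: eq_Rintegral => t; rewrite inE /= in_itv/= => /andP[t0 ty].
by rewrite /f patchE mem_set//= in_itv/= t0 (le_trans ty)// ltW.
Unshelve. all: by end_near. Qed.

(** The density is explicit because the first variation takes it as an argument; linear operations
    then act on pairs (v, g). *)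
Definition H10_density v g := square_integrable mu I g /\
  (forall x, I x -> v x = \int[mu]_(t in `[0, x]) g t) /\ v T = 0.

Lemma H10P v : H10 T v <-> exists g, H10_density v g.
Proof.
split=> -[g [g2 vg]]; exists g; split => //; case: g2 => mg ig; split => //.
  apply/integrableP; split; first by apply/measurable_EFinP; exact: measurable_funX.
  by apply: le_lt_trans ig; under eq_integral do rewrite /= ger0_norm ?sqr_ge0//.
move/integrableP : ig => [_]; apply: le_lt_trans.
by under [leRHS]eq_integral do rewrite /= ger0_norm ?sqr_ge0//.
Qed.

Section one_density.
Variables (v g : R -> R) (vg : H10_density v g).

Lemma density_integrable : mu.-integrable I (EFin \o g).
Proof. by apply: square_integrable_int => //; case: vg. Qed.

Lemma density_sub_integrable x : I x -> mu.-integrable `[0, x] (EFin \o g).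
Proof.
rewrite /= in_itv /= => /andP[x0 xT]; apply: integrableS density_integrable => //.
by apply: subset_itvl; rewrite bnd_simp.
Qed.

Lemma density_continuous : {within I, continuous v}.
Proof.
have := parameterized_integral_continuous (ltW T0) density_integrable.
apply: subspace_eq_continuous => x /set_mem Ix.
by rewrite /from_subspace /= (vg.2.1 _ Ix).
Qed.

Lemma density_measurable : measurable_fun I v.
Proof. exact: within_continuous_measurable density_continuous. Qed.

Lemma density_bounded : exists M, forall x, I x -> `|v x| <= M.
Proof. exact: within_continuous_bounded (ltW T0) density_continuous. Qed.

Lemma density_ae_derive : exists N, [/\ measurable N, mu N = 0%E &
  forall x, `]0, T[%classic x -> ~ N x -> is_derive x 1 v (g x)].
Proof. exact: Rintegral_ae_derive density_integrable vg.2.1. Qed.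

End one_density.

Lemma H10_densityD v g w h : H10_density v g -> H10_density w h ->
  H10_density (fun x => v x + w x) (fun x => g x + h x).
Proof.
move=> vg wh; split; first by apply: square_integrableD => //; [case: vg|case: wh].
split; last by rewrite vg.2.2 wh.2.2 addr0.
move=> x Ix; rewrite RintegralD//; first by rewrite -(vg.2.1 _ Ix) -(wh.2.1 _ Ix).
- exact: (density_sub_integrable vg Ix).
- exact: (density_sub_integrable wh Ix).
Qed.

Lemma H10_densityZ k v g : H10_density v g ->
  H10_density (fun x => k * v x) (fun x => k * g x).
Proof.
move=> vg; split; first by apply: square_integrableZ => //; case: vg.
split; last by rewrite vg.2.2 mulr0.
move=> x Ix; rewrite RintegralZl//; first by rewrite -(vg.2.1 _ Ix).
exact: (density_sub_integrable vg Ix).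
Qed.

End sobolev_density.

(** * Stieltjes measures carried by [0, L] *)

Section stieltjes_mass.
Context (R : realType) (Phi : cumulative R R) (L : R).
Hypothesis L0 : 0 <= L.
Hypothesis Phi0 : forall x, x < 0 -> Phi x = 0.
Hypothesis PhiL : forall x, L <= x -> Phi x = Phi L.
Local Notation nu := (lebesgue_stieltjes_measure Phi).

Lemma stieltjes_oc (a b : R) : a <= b -> nu `]a, b] = (Phi b - Phi a)%:E.
Proof.
move=> ab; rewrite /lebesgue_stieltjes_measure /measure_extension.
by rewrite measurable_mu_extE/= ?wlength_itv_bnd//; exact: is_ocitv.
Qed.

Lemma stieltjes_off_segment : nu (~` `[0, L]) = 0%E.
Proof.
apply: measure_negligible; first exact: measurableC.
(* Half-open pieces have mass equal to the increment of [Phi], which is zero here. On the left they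
   stop short of 0, where [Phi] may jump. *)
apply: (@negligibleS _ _ _ nu (\bigcup_n (`](- n.+1%:R), (- n.+1%:R^-1)] `|` `]L, L + n%:R]))).
  move=> x /=; rewrite in_itv/= => /negP; rewrite negb_and -!ltNge => /orP[x0|Lx].
    exists (maxn (Num.truncn (- x)) (Num.truncn (- x^-1))) => //; left.
    rewrite /= in_itv/=; set p := maxn _ _.
    have px : - x < p.+1%:R.
      apply: lt_le_trans (truncnS_gt _) _.
      by rewrite ler_nat ltnS leq_maxl.
    have px' : - x^-1 < p.+1%:R.
      apply: lt_le_trans (truncnS_gt _) _.
      by rewrite ler_nat ltnS leq_maxr.
    apply/andP; split; first by rewrite ltrNl.
    rewrite lerNr -[- x]invrK lef_pV2 ?posrE ?invr_gt0 ?oppr_gt0//.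
    by rewrite invrN ltW.
  exists (Num.truncn (x - L)).+1 => //; right; rewrite /= in_itv/= Lx/=.
  by rewrite -lerBlDl ltW// truncnS_gt.
apply: negligible_bigcup => n; apply: negligibleU; apply/negligibleP => //.
  apply: etrans (stieltjes_oc _) _.
    by rewrite lerN2 (@le_trans _ _ 1)// ?invf_le1// ler1n.
  by rewrite !Phi0 ?subrr// oppr_lt0 ?invr_gt0.
apply: etrans (stieltjes_oc _) _; first by rewrite lerDl.
by rewrite PhiL ?lerDl// subrr.
Qed.

(** Starting at -1, where [Phi] vanishes, includes the possible atom at 0, of mass [Phi 0]. *)
Lemma stieltjes_segmentI (t : R) : 0 <= t -> nu (`]-1, t] `&` `[0, L]) = (Phi t)%:E.
Proof.
move=> t0; have t1 : -1 <= t by rewrite (le_trans _ t0)// lerN10.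
have := stieltjes_oc t1; rewrite (@Phi0 (-1)) ?ltrN10// subr0 => <-.
apply/esym; apply: etrans (@measureDI _ _ _ nu `]-1, t]%classic `[0, L]%classic _ _) _ => //.
rewrite -[RHS]add0e; congr (_ + _)%E.
apply/eqP; rewrite -measure_le0 -stieltjes_off_segment le_measure ?inE//.
- exact: measurableD.
- exact: measurableC.

Qed.

Lemma stieltjes_segment : nu `[0, L] = (Phi L)%:E.
Proof.
rewrite -(stieltjes_segmentI L0); congr (nu _); apply/seteqP; split => x; last by case.
move=> xL; split => //; move: xL; rewrite /= !in_itv/= => /andP[x0 ->].
by rewrite (lt_le_trans _ x0)// ltrN10.
Qed.

(** On [0, L] the function chi lies between the indicators of []-1, s]] and []-1, e]]. *)
Lemma stieltjes_cutoff (chi : R -> R) (s e : R) :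
  0 <= s -> s <= e -> measurable_fun `[0, L] chi ->
  (forall x, `[0, L]%classic x -> 0 <= chi x <= 1) ->
  (forall x, `[0, L]%classic x -> x <= s -> chi x = 1) ->
  (forall x, `[0, L]%classic x -> e <= x -> chi x = 0) ->
  Phi s <= \int[nu]_(x in `[0, L]) chi x <= Phi e.
Proof.
move=> s0 se mchi chi01 chi1 chi0.
have nuL : (nu `[0%R, L] < +oo)%E by rewrite stieltjes_segment ltry.
have ichi : nu.-integrable `[0, L] (EFin \o chi).
  apply: (@integrable_bounded _ _ _ nu _ _ _ _ 1) => // x Ix.
  by have /andP[? ?] := chi01 _ Ix; rewrite ger0_norm.
have iind t : nu.-integrable `[0, L] (EFin \o \1_(`]-1, t]%classic : set R)).
  apply: (@integrable_bounded _ _ _ nu _ _ _ _ 1) => //.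
  by move=> x _; rewrite indicE; case: (_ \in _); rewrite ?normr1 ?normr0.
have vind t : 0 <= t -> \int[nu]_(x in `[0, L]) (\1_(`]-1, t]%classic : set R) x) = Phi t.
  by move=> t0; rewrite /Rintegral integral_indic//; apply: (congr1 fine (stieltjes_segmentI t0)).
rewrite -(vind _ s0) -[X in _ <= _ <= X](vind e) ?(le_trans s0)//.
apply/andP; split; apply: le_Rintegral => // x Ix; have /andP[c0 c1] := chi01 _ Ix.
  rewrite indicE; case: (boolP (x \in _)) => // /set_mem /=.
  by rewrite in_itv/= => /andP[_ xs]; rewrite chi1.
rewrite indicE; case: (boolP (x \in _)) => // /negP xe; rewrite chi0//.
move: Ix; rewrite /= in_itv/= => /andP[x0 _].
rewrite leNgt; apply/negP => /ltW ex; apply: xe; rewrite inE /= in_itv/= ex.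
by rewrite (lt_le_trans _ x0)// ltrN10.
Qed.

End stieltjes_mass.

(** * Riesz representation of a positive functional with enough cutoffs *)

Section positive_functional.
Context (R : realType) (L : R) (L0 : 0 < L).
Local Notation J := (`[0%R, L]%classic : set R).
(** The graph of a linear functional: [P p l] reads as p having value l. Two values of the same p
    coincide, since positivity applies to the zero function p - p with either difference of the
    values. In the application L is T - 1, so the bound L + 1 in [P_cut] is T. *)
Variable P : (R -> R) -> R -> Prop.
Hypothesis PD : forall p l q m, P p l -> P q m -> P (fun x => p x + q x) (l + m).
Hypothesis PZ : forall k p l, P p l -> P (fun x => k * p x) (k * l).
Hypothesis P_ge0 : forall p l, P p l -> (forall x, J x -> 0 <= p x) -> 0 <= l.
Hypothesis P_lip : forall p l, P p l ->
  exists C, forall x y, J x -> J y -> `|p x - p y| <= C * `|x - y|.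
Hypothesis P_cut : forall n i : nat, (1 < n)%N -> i.+1%:R / n%:R <= L + 1 ->
  exists p l, P p l /\ forall x, J x -> [/\ 0 <= p x <= 1,
    x <= i%:R / n%:R -> p x = 1 & i.+1%:R / n%:R <= x -> p x = 0].

Let PB p l q m : P p l -> P q m -> P (fun x => p x - q x) (l - m).
Proof.
move=> Pp Pq; have := PD Pp (PZ (-1) Pq); rewrite mulN1r.
by under eq_fun do rewrite mulN1r.
Qed.

Let upper (x : R) := [set l | exists p, P p l /\
  (forall t, J t -> 0 <= p t) /\ forall t, J t -> t <= x -> 1 <= p t].

Let Phi (x : R) := inf (upper x).

(** The index i + 1 overshoots L n by at most 2, and 2/n <= 1. Hence the cutoff that equals 1 on all
    of [0, L] is still among those given by [P_cut]. *)
Lemma grid_bound (n : nat) : (1 < n)%N -> let i := (Num.truncn (L * n%:R)).+1 in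
  L <= i%:R / n%:R /\ i.+1%:R / n%:R <= L + 1.
Proof.
move=> n1 /=; have n0 : 0 < n%:R :> R by rewrite ltr0n (ltn_trans _ n1).
have Ln : 0 <= L * n%:R by rewrite mulr_ge0// ltW.
split; first by rewrite ler_pdivlMr// ltW// truncnS_gt.
have : (Num.truncn (L * n%:R))%:R <= L * n%:R by rewrite truncn_le.
rewrite ler_pdivrMr// mulrDl mul1r.
have : 2 <= n%:R :> R by rewrite (ler_nat _ 2).
by rewrite -[in X in _ -> _ -> X]addn2 natrD; lra.
Qed.

Let upper_ge0 x : lbound (upper x) 0.
Proof. by move=> l [p [Pp [p0 _]]]; exact: P_ge0 Pp p0. Qed.

Let upper_nonempty x : upper x !=set0.
Proof.
have [Li iL] := grid_bound (isT : (1 < 2)%N).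
have [p [l [Pp Hp]]] := P_cut (isT : (1 < 2)%N) iL.
exists l, p; split => //; split => t Jt; have [/andP[p0 p1] p1' _] := Hp t Jt => // _.
rewrite p1'// (le_trans _ Li)//.
by move: Jt; rewrite /= in_itv/= => /andP[].
Qed.

Let has_inf_upper x : has_inf (upper x).
Proof. by split; [exact: upper_nonempty|exists 0; exact: upper_ge0]. Qed.

Let Phi_le x p l : P p l -> (forall t, J t -> 0 <= p t) ->
  (forall t, J t -> t <= x -> 1 <= p t) -> Phi x <= l.
Proof.
move=> Pp p0 p1; apply: ge_inf; first by exists 0; exact: upper_ge0.
by exists p.
Qed.

Let Phi_ge0 x : 0 <= Phi x.
Proof. exact/lb_le_inf/upper_ge0. Qed.

Let Phi_homo : {homo Phi : x y / x <= y}.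
Proof.
move=> x y xy; apply: lb_le_inf => // l [p [Pp [p0 p1]]].
by apply: Phi_le Pp p0 _ => t Jt tx; apply: p1 => //; exact: le_trans xy.
Qed.

Let Phi_lt0 x : x < 0 -> Phi x = 0.
Proof.
move=> x0; apply/eqP; rewrite eq_le Phi_ge0 andbT.
have [l [p [Pp _]]] := upper_nonempty 0.
have := PZ 0 Pp; rewrite mul0r => /Phi_le; apply.
  by move=> t _; rewrite mul0r.
move=> t; rewrite /= in_itv/= => /andP[t0 _] tx.
by move: x0; rewrite ltNge (le_trans t0 tx).
Qed.

Let Phi_geL x : L <= x -> Phi x = Phi L.
Proof.
move=> Lx; rewrite /Phi; congr inf; apply/seteqP; split => l [p [Pp [p0 p1]]];
  exists p; split => //; split => // t Jt tx; apply: p1 => //.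
- exact: le_trans Lx.
- by move: Jt; rewrite /= in_itv/= => /andP[].
Qed.

(** A nearly optimal majorant p for x, scaled by 1 + k, still exceeds 1 slightly to the right of x
    because p is Lipschitz; its value grows only by k l. *)
Let Phi_right x e : 0 < e -> exists2 d, 0 < d & forall y, y < x + d -> Phi y < Phi x + e.
Proof.
move=> e0; have [l [p [Pp [p0 p1]]] lx] := inf_adherent e0 (has_inf_upper x).
have l0 : 0 <= l by exact: P_ge0 Pp p0.
have [C0 pC0] := P_lip Pp.
have [C C_gt0 pC] : exists2 C, 0 < C & forall x y, J x -> J y -> `|p x - p y| <= C * `|x - y|.
  exists (`|C0| + 1); first by rewrite ltr_wpDl.
  move=> s t Js Jt; apply: le_trans (pC0 _ _ Js Jt) _.
  by rewrite ler_wpM2r// (le_trans (ler_norm _))// lerDl.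
(* Chosen so that k l stays below the slack [Phi x + e - l]; the shift l + 1 covers l = 0. *)
pose k := (Phi x + e - l) / (2 * (l + 1)).
have l1 : 0 < 2 * (l + 1) by rewrite mulr_gt0// ltr_wpDl.
have k0 : 0 < k by rewrite divr_gt0// subr_gt0.
have kl : (1 + k) * l < Phi x + e.
  have : k * (2 * (l + 1)) = Phi x + e - l by rewrite divfK ?gt_eqF.
  nra.
suff [d d0 H] : exists2 d, 0 < d & forall t, J t -> t < x + d -> 1 <= (1 + k) * p t.
  exists d => // y yd; apply: le_lt_trans kl; apply: Phi_le (PZ (1 + k) Pp) _ _.
    by move=> t Jt; rewrite mulr_ge0 ?p0// addr_ge0// ltW.
  by move=> t Jt ty; apply: H => //; exact: le_lt_trans yd.
have [x0|x0] := ltP x 0.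
  exists (- x); first by rewrite oppr_gt0.
  by move=> t; rewrite subrr /= in_itv/= => /andP[t0 _]; rewrite ltNge t0.
have [Lx|xL] := leP L x.
  exists 1 => // t Jt _; have := p1 t Jt.
  have -> : t <= x by move: Jt; rewrite /= in_itv/= => /andP[_ tL]; exact: le_trans Lx.
  by move=> /(_ isT); nra.
have Jx : J x by rewrite /= in_itv/= x0 ltW.
have k1 : 0 < 1 + k by rewrite addr_gt0.
(* Over this distance p loses less than k/(1+k), so it stays above 1/(1+k). *)
exists (k / (1 + k) / C); first by rewrite divr_gt0// divr_gt0.
move=> t Jt tx; have [tx'|xt] := leP t x; first by have := p1 t Jt tx'; nra.
have h : p x - p t <= C * (t - x).
  rewrite (le_trans (ler_norm _))// (le_trans (pC _ _ Jx Jt))// (ler_wpM2l (ltW C_gt0))//.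
  by rewrite distrC ger0_norm// subr_ge0 ltW.
have px := p1 x Jx (lexx _).
move: tx; rewrite -ltrBlDl ltr_pdivlMr// ltr_pdivlMr// => tx.
nra.
Qed.

Let Phi_right_continuous : right_continuous Phi.
Proof.
move=> x; apply/cvgrPdist_le => e e0; have [d d0 H] := Phi_right x e0.
near=> y; have xy : x < y by [].
have yd : y < x + d by near: y; apply: nbhs_right_lt; rewrite ltrDl.
have := H y yd; have := Phi_homo (ltW xy) => h1 h2.
by rewrite distrC ger0_norm ?subr_ge0// lerBlDl ltW.
Unshelve. all: by end_near. Qed.

HB.instance Definition _ := isCumulative.Build R _ R Phi Phi_homo Phi_right_continuous.

Local Notation nu := (lebesgue_stieltjes_measure Phi).

Let within_lip p l : P p l -> {within J, continuous p}.
Proof.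
move=> /P_lip[C pC]; apply/subspace_continuousP => x Jx.
apply/cvgrPdist_le => e e0.
have C1 : 0 < `|C| + 1 by rewrite ltr_wpDl.
near=> y; have Jy : J y by near: y; exact: withinT.
apply: le_trans (pC _ _ Jx Jy) _.
apply: (@le_trans _ _ ((`|C| + 1) * `|x - y|)).
  by rewrite ler_wpM2r// (le_trans (ler_norm _))// lerDl.
rewrite -ler_pdivlMl// mulrC; near: y; apply: cvg_within.
by apply: filterS (nbhsx_ballx x _ (divr_gt0 e0 C1)) => y /ltW.
Unshelve. all: by end_near. Qed.

Let integrable_P p l : P p l -> nu.-integrable J (EFin \o p).
Proof.
move=> /within_lip cp; have [M pM] := within_continuous_bounded (ltW L0) cp.
apply: (@integrable_bounded _ _ _ nu _ _ _ _ M) => //.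
- have E := @stieltjes_segment R Phi L (ltW L0) Phi_lt0 Phi_geL.
  by apply: le_lt_trans (ltry (Phi L)); rewrite le_eqVlt; apply/orP; left; apply/eqP; exact: E.
- exact: within_continuous_measurable.
Qed.

Let nuI p := \int[nu]_(x in J) p x.

Let nuI_le p l q m : P p l -> P q m -> (forall x, J x -> p x <= q x) -> nuI p <= nuI q.
Proof. by move=> Pp Pq pq; apply: le_Rintegral => //; [exact: integrable_P Pp|exact: integrable_P Pq]. Qed.

Let P_le p l q m : P p l -> P q m -> (forall x, J x -> p x <= q x) -> l <= m.
Proof.
by move=> Pp Pq pq; rewrite -subr_ge0; apply: P_ge0 (PB Pq Pp) _ => x Jx; rewrite subr_ge0 pq.
Qed.

(* With [y j = chi_j x] and [c j = p (j/n)] this approximates [p x]: the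
   differences [chi_j - chi_(j-1)] form a partition of unity on the grid. *)
Let abel (c y : nat -> R) := fix S m :=
  if m is m'.+1 then S m' + c m'.+1 * (y m'.+1 - y m') else c 0%N * y 0%N.

(** On the grid of mesh 1/n, p is replaced by an Abel sum of cutoffs. Both functionals send the j-th
    cutoff into [[Phi (t j)], [Phi (t j.+1)]], so summation by parts bounds their disagreement on
    the Abel sum by the oscillation of p over a cell times a telescoping sum of increments. *)
Theorem positive_functional_stieltjes : exists Psi : cumulative R R,
  [/\ forall x, x < 0 -> Psi x = 0, forall x, L <= x -> Psi x = Psi L &
  forall p l, P p l -> \int[lebesgue_stieltjes_measure Psi]_(x in J) p x = l].
Proof.
exists Phi; split => // p l Pp; rewrite -/(nuI p).
have [C0 pC0] := P_lip Pp.
have [C C_gt0 pC] : exists2 C, 0 < C & forall x y, J x -> J y -> `|p x - p y| <= C * `|x - y|.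
  exists (`|C0| + 1); first by rewrite ltr_wpDl.
  move=> s t Js Jt; apply: le_trans (pC0 _ _ Js Jt) _.
  by rewrite ler_wpM2r// (le_trans (ler_norm _))// lerDl.
(* Three errors of size C/n times [Phi L]: replacing p by the Abel sum in l, the same in the
   integral, and comparing the two functionals on the Abel sum. *)
suff H (n : nat) : (1 < n)%N -> `|l - nuI p| <= 3 * (C / n%:R) * Phi L.
  apply/esym/eqP; rewrite -subr_eq0 -normr_le0 leNgt; apply/negP => D0.
  pose n := (Num.truncn (3 * C * Phi L / `|l - nuI p|)).+2.
  have := H n isT; rewrite leNgt => /negP; apply.
  have : 3 * C * Phi L / `|l - nuI p| < n%:R.
    by apply: lt_le_trans (truncnS_gt _) _; rewrite ler_nat.
  rewrite ltr_pdivrMr// => nD.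
  have -> : 3 * (C / n%:R) * Phi L = 3 * C * Phi L / n%:R by ring.
  by rewrite ltr_pdivrMr// [ltRHS]mulrC.
move=> n1; have n0 : 0 < n%:R :> R by rewrite ltr0n (ltn_trans _ n1).
have [] := grid_bound n1; set M := (Num.truncn (L * n%:R)).+1 => LM ML.
pose e := C / n%:R.
pose t (j : nat) : R := j%:R / n%:R.
have tS j : t j <= t j.+1 by rewrite ler_pM2r ?invr_gt0// ler_nat.
have t_homo i j : (i <= j)%N -> t i <= t j.
  by move=> ij; rewrite ler_pM2r ?invr_gt0// ler_nat.
have t0 j : 0 <= t j by rewrite divr_ge0.
have tjL j : (j <= M)%N -> t j.+1 <= L + 1.
  by move=> jM; apply: le_trans ML; exact: t_homo.
(* Beyond M no cutoff is available; [(cst 0, 0)] is a placeholder there. *)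
have /choice[chil Hchi] (j : nat) : exists ql : (R -> R) * R, (j <= M)%N ->
    P ql.1 ql.2 /\ forall x, J x -> [/\ 0 <= ql.1 x <= 1,
    x <= t j -> ql.1 x = 1 & t j.+1 <= x -> ql.1 x = 0].
  have [jM|jM] := leqP j M; last by exists (cst 0, 0).
  by have [q [m Hq]] := P_cut n1 (tjL _ jM); exists (q, m).
pose chi j := (chil j).1; pose lc j := (chil j).2; pose ic j := nuI (chi j).
have Pchi j : (j <= M)%N -> P (chi j) (lc j) by move=> /Hchi[].
have chi01 j x : (j <= M)%N -> J x -> 0 <= chi j x <= 1.
  by move=> /Hchi[_ H] /H[].
have chi1 j x : (j <= M)%N -> J x -> x <= t j -> chi j x = 1.
  by move=> /Hchi[_ H] /H[].
have chi0 j x : (j <= M)%N -> J x -> t j.+1 <= x -> chi j x = 0.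
  by move=> /Hchi[_ H] /H[].
have lcP j : (j <= M)%N -> Phi (t j) <= lc j <= Phi (t j.+1).
  move=> jM; apply/andP; split.
    apply: Phi_le (Pchi _ jM) _ _ => x Jx; first by have /andP[] := chi01 _ _ jM Jx.
    by move=> xt; rewrite chi1.
  apply: lb_le_inf => // m [q [Pq [q0 q1]]]; apply: (P_le (Pchi _ jM) Pq) => x Jx.
  have [xt|tx] := leP x (t j.+1); first by rewrite (le_trans _ (q1 _ Jx xt))//; have /andP[] := chi01 _ _ jM Jx.
  by rewrite chi0 ?q0// ltW.
have icP j : (j <= M)%N -> Phi (t j) <= ic j <= Phi (t j.+1).
  move=> jM; apply: stieltjes_cutoff => //; first exact: ltW.
  - exact: (within_continuous_measurable (within_lip (Pchi _ jM))).
  - by move=> x; exact: chi01.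
  - by move=> x; exact: chi1.
  - by move=> x; exact: chi0.
(* Samples are clipped to L because the grid runs past the end of J, where nothing is known about
   p. *)
pose c j := p (Num.min (t j) L).
have Jmin j : J (Num.min (t j) L).
  by rewrite /= in_itv/= le_min t0 ge_min lexx orbT ltW.
have cS j : `|c j - c j.+1| <= e.
  apply: le_trans (pC _ _ (Jmin _) (Jmin _)) _; rewrite ler_wpM2l ?(ltW C_gt0)//.
  have := tS j; have : t j.+1 = t j + n%:R^-1 by rewrite /t -natr1 mulrDl mul1r.
  rewrite ler_norml /Num.min => tE tt.
  by case: ltP => ? ; case: ltP => ?; apply/andP; split; lra.
have near_c j x : J x -> `|x - t j| <= n%:R^-1 -> `|p x - c j| <= e.
  move=> Jx xt; apply: le_trans (pC _ _ Jx (Jmin _)) _; rewrite ler_wpM2l ?(ltW C_gt0)//.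
  move: Jx xt; rewrite /= in_itv/= => /andP[x0 xL]; rewrite !ler_norml /Num.min => /andP[h1 h2].
  by case: ltP => ?; apply/andP; split; lra.
pose S m (x : R) := abel c (chi ^~ x) m.
pose s := abel c lc.
pose r := abel c ic.
have PdS m : (m < M)%N -> P (fun x => chi m.+1 x - chi m x) (lc m.+1 - lc m).
  by move=> mM; apply: PB; apply: Pchi => //; exact: ltnW.
have PS m : (m <= M)%N -> P (S m) (s m).
  elim: m => [|m IH] mM; first exact: PZ (Pchi _ _).
  exact: PD (IH (ltnW mM)) (PZ _ (PdS _ mM)).
have IS m : (m <= M)%N -> nuI (S m) = r m.
  elim: m => [|m IH] mM.
    by rewrite /nuI /S /= RintegralZl//; exact: integrable_P (Pchi _ _).
  have mM' := ltnW mM.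
  rewrite [LHS]RintegralD//; last 2 first.
  - exact: integrable_P (PS _ mM').
  - exact: integrable_P (PZ _ (PdS _ mM)).
  rewrite -/(nuI _) IH// RintegralZl//; last exact: integrable_P (PdS _ mM).
  by rewrite RintegralB//; [exact: integrable_P (Pchi _ mM)|exact: integrable_P (Pchi _ mM')].
(* The increment [chi m.+1 x - chi m x] vanishes unless x lies between [t m] and [t m.+2], hence
   within 1/n of [t m.+1], the point sampled by its coefficient. Measuring the error against
   [chi m x] lets the induction telescope. *)
have Sp m x : (m <= M)%N -> J x -> `|p x * chi m x - S m x| <= e * chi m x.
  move=> + Jx; elim: m => [|m IH] mM; have /andP[ch0 ch1] := chi01 _ _ mM Jx.
    rewrite /S /= -mulrBl normrM (ger0_norm ch0).
    have [x1|x1] := leP (t 1%N) x; first by rewrite chi0// !mulr0.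
    rewrite ler_wpM2r// near_c// /t mul0r subr0 ger0_norm.
      by move: x1; rewrite /t mul1r => /ltW.
    by move: Jx; rewrite /= in_itv/= => /andP[].
  have mM' := ltnW mM; have /andP[dh0 dh1] := chi01 _ _ mM' Jx.
  have d0 : 0 <= chi m.+1 x - chi m x.
    rewrite subr_ge0; have [xt|tx] := leP x (t m.+1); first by rewrite (chi1 _ _ mM).
    by rewrite (chi0 _ _ mM')// ltW.
  have -> : p x * chi m.+1 x - S m.+1 x = (p x * chi m x - S m x) +
      (p x - c m.+1) * (chi m.+1 x - chi m x) by rewrite /S /=; ring.
  have -> : e * chi m.+1 x = e * chi m x + e * (chi m.+1 x - chi m x) by ring.
  apply: le_trans (ler_normD _ _) _; apply: lerD; first exact: IH.
  rewrite normrM (ger0_norm d0).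
  have tE j : t j.+1 = t j + n%:R^-1 by rewrite /t -natr1 mulrDl mul1r.
  have [xt|tx] := leP x (t m); first by rewrite (chi1 _ _ mM) ?(chi1 _ _ mM')// ?subrr ?mulr0// (le_trans xt).
  have [tx'|xt'] := leP (t m.+2) x.
    by rewrite (chi0 _ _ mM) ?(chi0 _ _ mM')// ?subrr ?mulr0// (le_trans _ tx').
  rewrite ler_wpM2r// near_c// ler_norml; move: tx xt'; rewrite !tE => tx xt'.
  by apply/andP; split; lra.
(* Summation by parts with the boundary term subtracted; at m = M that term is zero, as [lc M] and
   [ic M] both equal [Phi L]. *)
have sr m : (m <= M)%N -> `|s m - r m - c m * (lc m - ic m)| <= e * Phi (t m).
  elim: m => [|m IH] mM.
    rewrite (_ : s 0%N - r 0%N - _ = 0) ?normr0; first by rewrite mulr_ge0// divr_ge0// ltW.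
    by rewrite /s /r /=; ring.
  have mM' := ltnW mM; have {IH} := IH mM'.
  have /andP[l1 l2] := lcP _ mM'; have /andP[i1 i2] := icP _ mM'.
  have -> : s m.+1 - r m.+1 - c m.+1 * (lc m.+1 - ic m.+1) =
     (s m - r m - c m * (lc m - ic m)) + (c m - c m.+1) * (lc m - ic m).
    by rewrite /s /r /=; ring.
  move=> IH; apply: le_trans (ler_normD _ _) _.
  have -> : e * Phi (t m.+1) = e * Phi (t m) + e * (Phi (t m.+1) - Phi (t m)) by ring.
  apply: lerD => //; rewrite normrM; apply: ler_pM => //.
  by rewrite ler_norml; apply/andP; split; lra.
have tML : Phi (t M) = Phi L by exact: Phi_geL.
have tML' : Phi (t M.+1) = Phi L by apply: Phi_geL; exact: le_trans (tS M).
have lM : lc M = Phi L.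
  by apply/eqP; rewrite eq_le; have := lcP M (leqnn _); rewrite tML tML' andbC.
have iM : ic M = Phi L.
  by apply/eqP; rewrite eq_le; have := icP M (leqnn _); rewrite tML tML' andbC.
have Se x : J x -> `|p x - S M x| <= e.
  move=> Jx; have := Sp M x (leqnn _) Jx; rewrite (chi1 M)// ?mulr1//.
  by move: Jx; rewrite /= in_itv/= => /andP[_ xL]; exact: le_trans LM.
have Pe := PZ e (Pchi M (leqnn _)).
have PSM := PS M (leqnn _).
have chiM x : J x -> chi M x = 1.
  move=> Jx; apply: chi1 => //.
  by move: Jx; rewrite /= in_itv/= => /andP[_ xL]; exact: le_trans LM.
have up x : J x -> p x <= S M x + e * chi M x.
  by move=> Jx; rewrite chiM// mulr1; have := Se x Jx; rewrite ler_norml => /andP[? ?]; lra.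
have down x : J x -> S M x <= p x + e * chi M x.
  by move=> Jx; rewrite chiM// mulr1; have := Se x Jx; rewrite ler_norml => /andP[? ?]; lra.
have l_up := P_le Pp (PD PSM Pe) up; have l_down := P_le PSM (PD Pp Pe) down.
have i_up := nuI_le Pp (PD PSM Pe) up; have i_down := nuI_le PSM (PD Pp Pe) down.
have nuID q m : P q m -> nuI (fun x => q x + e * chi M x) = nuI q + e * Phi L.
  move=> Pq; rewrite /nuI RintegralD//; [|exact: integrable_P Pq|exact: integrable_P Pe].
  by rewrite RintegralZl ?(integrable_P (Pchi M (leqnn _)))// -/(nuI (chi M)) -/(ic M) iM.
move: i_up i_down; rewrite (nuID _ _ PSM) (nuID _ _ Pp) IS// => i_up i_down.
have := sr M (leqnn _); rewrite lM iM subrr mulr0 subr0 tML -/e ler_norml => /andP[sr1 sr2].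
rewrite lM in l_up l_down.
by rewrite ler_norml; apply/andP; split; lra.
Qed.

End positive_functional.

(** * Differentiable functions and the square of the positive part *)

Section C1_functions.
Context (R : realType).
Local Notation mu := (@lebesgue_measure R).

Lemma Rintegral_derive (a b : R) (F f : R -> R) : a <= b ->
  (forall x, `[a, b]%classic x -> is_derive x 1 F (f x)) ->
  {within `[a, b], continuous f} ->
  \int[mu]_(x in `[a, b]) f x = F b - F a.
Proof.
rewrite le_eqVlt => /predU1P[-> _ _|ab dF cf].
  by rewrite set_itv1 Rintegral_set1 subrr.
have cF x : `[a, b]%classic x -> F z @[z --> x] --> F x.
  move=> /dF[dFx _]; apply: differentiable_continuous.
  by rewrite -derivable1_diffP.
rewrite /Rintegral (continuous_FTC2 ab cf (F := F))//.
- split.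
  + move=> x /subset_itv_oo_cc xab; by have [] := dF x xab.
  + by apply: cvg_at_right_filter; apply: cF; rewrite /= in_itv/= lexx ltW.
  + by apply: cvg_at_left_filter; apply: cF; rewrite /= in_itv/= lexx ltW.
- move=> x /subset_itv_oo_cc xab; rewrite derive1E.
  by have ? := dF x xab; rewrite derive_val.
Qed.

Lemma H10_density_C1 (T : R) (v g : R -> R) : 0 < T ->
  (forall x : R, is_derive x 1 v (g x)) -> continuous g -> v 0 = 0 -> v T = 0 ->
  H10_density T v g.
Proof.
move=> T0 dv cg v0 vT; split.
  have cgT : {within `[0, T], continuous g} by exact: continuous_subspaceT.
  have [M gM] := within_continuous_bounded (ltW T0) cgT.
  apply: (@square_integrable_bounded _ _ _ mu _ _ _ _ M) => //.
    exact: lebesgue_segment_lty.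
  exact: within_continuous_measurable.
split => // x; rewrite /= in_itv/= => /andP[x0 _].
rewrite (Rintegral_derive x0 (F := v)) ?v0 ?subr0//.
by apply: continuous_subspaceT.
Qed.

Lemma is_derive_sqr_posp (x : R) : is_derive x 1 (fun y => Num.max 0 y ^+ 2) (2 * Num.max 0 x).
Proof.
have [x0|x0|->] := ltgtP x 0.
- rewrite mulr0.
  apply: (near_eq_is_derive _ (is_derive_cst 0 x 1)).
  near=> y; rewrite max_l ?expr0n//; apply: ltW; near: y; exact: lt_nbhsl.
- have dX : is_derive x 1 (fun y : R => y ^+ 2) (2 * x).
    by apply: is_derive_eq; rewrite /GRing.scale/=; ring.
  apply: (near_eq_is_derive _ dX).
  near=> y; rewrite max_r//; apply: ltW; near: y; exact: lt_nbhsr.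
rewrite mulr0.
have H : h^-1 *: (Num.max 0 (h *: (1:R) + 0) ^+ 2 - Num.max 0 0 ^+ 2) @[h --> (0:R)^'] --> (0:R).
  apply/cvgrPdist_le => e e0; near=> h.
  rewrite maxxx expr0n/= subr0 addr0 sub0r normrN /GRing.scale/= mulr1.
  have he : `|h| <= e.
    near: h; apply: cvg_within.
    by apply: filterS (nbhsx_ballx (0:R) _ e0) => y; rewrite /ball/= sub0r normrN => /ltW.
  have [h0|h0] := ltP 0 h; last by rewrite expr0n/= mulr0 normr0 ltW.
  by rewrite expr2 mulKf ?gt_eqF.
by apply: DeriveDef; [apply: (cvgP 0)|apply: cvg_lim].
Unshelve. all: by end_near. Qed.

End C1_functions.

(** * Bumps, their integer translates, and cutoffs in the range of [B] *)

Section bump.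
Context (R : realType) (s e : R) (s0 : 0 <= s) (se : s < e).
Local Notation mu := (@lebesgue_measure R).

Let q (x : R) := (x - s) * (e - x).
(** The factor q is positive exactly on ]s, e[. Squaring its positive part gives a C^1 function, so
    [bump'] can serve as a density. *)
Definition bump (x : R) := Num.max 0 (q x) ^+ 2.
Definition bump' (x : R) := 2 * Num.max 0 (q x) * (s + e - 2 * x).

Lemma is_derive_bump (x : R) : is_derive x 1 bump (bump' x).
Proof.
have dq : is_derive x 1 q (s + e - 2 * x).
  rewrite /q; apply: is_derive_eq; rewrite /GRing.scale/=; ring.
have := @is_derive1_comp _ (fun y => Num.max 0 y ^+ 2) q x _ _ (is_derive_sqr_posp (q x)) dq.
by [].
Qed.

Lemma continuous_bump' : continuous bump'.
Proof.
have cq : continuous q.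
  by move=> x; apply: cvgM; apply: cvgB => //; exact: cvg_cst.
move=> x; apply: cvgM.
  apply: cvgM; first exact: cvg_cst.
  apply: (@continuous_max _ _ (cst 0) q); [exact: cvg_cst|exact: cq].
apply: cvgB; first exact: cvg_cst.
by apply: cvgM => //; exact: cvg_cst.
Qed.

Lemma continuous_bump : continuous bump.
Proof.
move=> x; have [dx _] := is_derive_bump x.
by apply: differentiable_continuous; rewrite -derivable1_diffP.
Qed.

Lemma continuous_bump_shift k : continuous (fun y => bump (y + k)).
Proof.
move=> y; apply: (@continuous_comp _ _ _ (fun z : R => z + k) bump).
  by apply: cvgD => //; exact: cvg_cst.
exact: continuous_bump.
Qed.

Lemma bump_ge0 x : 0 <= bump x. Proof. exact: sqr_ge0. Qed.

Lemma bump_eq0 x : (x <= s) || (e <= x) -> bump x = 0.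
Proof.
move=> H; rewrite /bump max_l ?expr0n//.
have /orP[xs|ex] := H.
  by rewrite mulr_le0_ge0 ?subr_le0 ?subr_ge0// (le_trans xs)// ltW.
by rewrite mulr_ge0_le0 ?subr_le0 ?subr_ge0// (le_trans _ ex)// ltW.
Qed.

(** The base point -1 makes 0 an interior point, where differentiability is needed; the values are
    those of a primitive from s. *)
Definition bump_prim (x : R) := \int[mu]_(t in `[-1, x]) bump t.

Let bump_int a b : mu.-integrable `[a, b] (EFin \o bump).
Proof. by apply: within_continuous_integrable; exact: continuous_subspaceT continuous_bump. Qed.

Lemma is_derive_bump_prim (x : R) : -1 < x -> is_derive x 1 bump_prim (bump x).
Proof.
move=> x1; have x2 : x < x + 1 by rewrite ltrDl.
have [dF Ff] := continuous_FTC1_closed x2 (bump_int (-1) (x + 1)) x1 (@continuous_bump x).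
by rewrite -Ff derive1E; exact: DeriveDef.
Qed.

Lemma bump_prim_nondecreasing x y : -1 <= x -> x <= y -> bump_prim x <= bump_prim y.
Proof.
move=> x1 xy; rewrite /bump_prim (Rintegral_segment_cat x1 xy)// lerDl.
by apply: Rintegral_ge0 => t _; exact: bump_ge0.
Qed.

Lemma bump_prim_left x : x <= s -> bump_prim x = 0.
Proof.
move=> xs; rewrite /bump_prim (@eq_Rintegral _ _ _ _ _ (cst 0)).
  by rewrite Rintegral_cst// mul0r.
move=> t; rewrite inE /= in_itv/= => /andP[_ tx].
by rewrite bump_eq0// (le_trans tx).
Qed.

Lemma bump_prim_right x : e <= x -> bump_prim x = bump_prim e.
Proof.
move=> ex; have e1 : -1 <= e by rewrite (le_trans _ (ltW se))// (le_trans _ s0)// lerN10.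
rewrite {1}/bump_prim (Rintegral_segment_cat e1 ex)// -/(bump_prim e).
rewrite [X in _ + X](@eq_Rintegral _ _ _ _ _ (cst 0)).
  by rewrite Rintegral_cst// mul0r addr0.
move=> t; rewrite inE /= in_itv/= => /andP[et _].
by rewrite bump_eq0// et orbT.
Qed.

(** Were the mass zero, monotonicity would make [bump_prim] vanish on [s, e], contradicting its
    positive derivative at the midpoint. *)
Lemma bump_prim_gt0 : 0 < bump_prim e.
Proof.
rewrite lt_def -{2}(bump_prim_left (lexx s)) bump_prim_nondecreasing ?ltW//; last first.
  by rewrite (lt_le_trans _ s0)// ltrN10.
rewrite andbT; apply/negP => /eqP E.
pose m := (s + e) / 2.
have sm : s < m by rewrite /m (midf_lt se).
have me : m < e by rewrite /m (midf_lt se).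
have dm : is_derive m 1 bump_prim (bump m).
  by apply: is_derive_bump_prim; rewrite (lt_trans _ sm)// (lt_le_trans _ s0)// ltrN10.
have dm0 : is_derive m 1 bump_prim 0.
  apply: (near_eq_is_derive _ (is_derive_cst 0 m 1)).
  near=> y; have sy : s <= y by apply: ltW; near: y; exact: lt_nbhsr.
  have ye : y <= e by apply: ltW; near: y; exact: lt_nbhsl.
  have s1 : -1 <= s by rewrite (le_trans _ s0)// lerN10.
  apply/eqP; rewrite eq_le -{1}(bump_prim_left (lexx s)) bump_prim_nondecreasing//= -E.
  by rewrite bump_prim_nondecreasing// (le_trans s1).
have : bump m = 0.
  by have [_ <-] := dm; have [_ <-] := dm0.
apply/eqP; rewrite /bump expf_eq0/= gt_eqF// lt_max; apply/orP; right.
by rewrite /q mulr_gt0// subr_gt0.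
Unshelve. all: by end_near. Qed.

Lemma Rintegral_bump_shift (k x : R) : 0 <= k -> 0 <= x ->
  \int[mu]_(y in `[x, x + 1]) bump (y + k) = bump_prim (x + k + 1) - bump_prim (x + k).
Proof.
move=> k0 x0.
have xx1 : x <= x + 1 by rewrite lerDl.
have dF (y : R) : `[x, x + 1]%classic y -> is_derive y 1 (fun z => bump_prim (z + k)) (bump (y + k)).
  rewrite /= in_itv/= => /andP[xy _].
  have yk : -1 < y + k.
    by rewrite (@lt_le_trans _ _ 0)// ?ltrN10// addr_ge0// (le_trans x0).
  have dk : is_derive y 1 (fun z : R => z + k) 1.
    by apply: is_derive_eq; rewrite addr0.
  by have := @is_derive1_comp _ bump_prim (fun z => z + k) y _ _ (is_derive_bump_prim yk) dk; rewrite mulr1.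
have cF := @continuous_subspaceT _ _ `[x, x + 1]%classic _ (@continuous_bump_shift k).
by rewrite (Rintegral_derive xx1 dF cF) addrAC.
Qed.

Definition comb (N : nat) (x : R) := (bump_prim e)^-1 * \sum_(k < N) bump (x + k%:R).
Definition comb' (N : nat) (x : R) := (bump_prim e)^-1 * \sum_(k < N) bump' (x + k%:R).

Lemma H10_density_comb (T : R) (N : nat) : e <= T ->
  (forall k : nat, (k%:R <= s) || (e <= k%:R)) ->
  H10_density T (comb N) (comb' N).
Proof.
move=> eT Hk; apply: H10_density_C1.
- by rewrite (lt_le_trans _ eT)// (le_lt_trans s0).
- move=> x; rewrite /comb /comb'.
  have dsum : is_derive x 1 (\sum_(k < N) (fun y : R => bump (y + k%:R)))
      (\sum_(k < N) bump' (x + k%:R)).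
    apply: is_derive_sum => k.
    have dk : is_derive x 1 (fun z : R => z + k%:R) 1.
      by apply: is_derive_eq; rewrite addr0.
    by have := @is_derive1_comp _ bump (fun z => z + k%:R) x _ _ (is_derive_bump (x + k%:R)) dk; rewrite mulr1.
  have := is_deriveZ (bump_prim e)^-1 dsum.
  congr (is_derive _ _ _ _); apply/funext => y /=.
  by rewrite fct_sumE.
- have csum : continuous (fun x : R => \sum_(k < N) bump' (x + k%:R)).
    elim: N => [|N IH].
      by under eq_fun do rewrite big_ord0; exact: cst_continuous.
    under eq_fun do rewrite big_ord_recr/=.
    move=> x; apply: cvgD; first exact: IH.
    apply: (@continuous_comp _ _ _ (fun z : R => z + N%:R) bump').
      by apply: cvgD => //; exact: cvg_cst.
    exact: continuous_bump'.
  by move=> x; apply: cvgM; [exact: cvg_cst|exact: csum].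
- by rewrite /comb big1 ?mulr0// => k _; rewrite add0r bump_eq0.
- rewrite /comb big1 ?mulr0// => k _; rewrite bump_eq0//.
  by rewrite (le_trans eT) ?orbT// lerDl.
Qed.

(** Shifting the window instead of the bump, the N unit windows tile [x, x + N]. The bump has no
    mass beyond e, so only the normalised mass to the right of x remains. *)
Lemma Bop_comb (N : nat) (x : R) : 0 <= x -> e <= N%:R ->
  Bop (comb N) x = 1 - bump_prim x / bump_prim e.
Proof.
move=> x0 eN; rewrite /Bop.
have ci k : mu.-integrable `[x, x + 1] (EFin \o (fun y => bump (y + k))).
  by apply: within_continuous_integrable; apply: continuous_subspaceT; exact: continuous_bump_shift.
have ciN M : mu.-integrable `[x, x + 1] (EFin \o (fun y => \sum_(k < M) bump (y + k%:R))).
  elim: M => [|M IH].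
    by under [X in EFin \o X]eq_fun do rewrite big_ord0; apply: integrable0.
  under [X in EFin \o X]eq_fun do rewrite big_ord_recr/=.
  exact: integrableD IH (ci _).
have -> : Rintegral lebR `[x, x + 1] (comb N) = (bump_prim e)^-1 *
    \sum_(k < N) \int[mu]_(y in `[x, x + 1]) bump (y + k%:R).
  rewrite /comb RintegralZl//; congr (_ * _).
  elim: {eN} N => [|M IH].
    rewrite big_ord0 (@eq_Rintegral _ _ _ _ _ (cst 0)); last by move=> t _; rewrite big_ord0.
    by rewrite Rintegral_cst// mul0r.
  rewrite big_ord_recr/= -IH -RintegralD//.
  by apply: eq_Rintegral => t _; rewrite big_ord_recr.
have -> : \sum_(k < N) \int[mu]_(y in `[x, x + 1]) bump (y + k%:R) =
    bump_prim (x + N%:R) - bump_prim x.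
  elim: {eN} N => [|N IH]; first by rewrite big_ord0 addr0 subrr.
  rewrite big_ord_recr/= IH Rintegral_bump_shift// -(addrA x) natr1.
  by rewrite addrC subrKA.
rewrite (@bump_prim_right (x + N%:R)); last by rewrite (le_trans eN)// lerDr.
by rewrite mulrBr mulVf ?gt_eqF ?bump_prim_gt0// mulrC.
Qed.

End bump.

Lemma cutoff_exists (R : realType) (T : R) (n i : nat) : (1 < n)%N ->
  i.+1%:R / n%:R <= T ->
  exists v g, H10_density T v g /\ forall x, 0 <= x ->
   [/\ 0 <= Bop v x <= 1, x <= i%:R / n%:R -> Bop v x = 1 &
       i.+1%:R / n%:R <= x -> Bop v x = 0].
Proof.
move=> n1 iT; have n0 : 0 < n%:R :> R by rewrite ltr0n (ltn_trans _ n1).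
set e := i.+1%:R / n%:R in iT *; set s := i%:R / n%:R.
have s0 : 0 <= s by rewrite divr_ge0.
have se : s < e by rewrite /s /e ltr_pM2r ?invr_gt0// ltr_nat.
(* After multiplication by n: the integer k n is at most i or at least i + 1. *)
have Hk (k : nat) : (k%:R <= s) || (e <= k%:R).
  rewrite /s /e ler_pdivlMr// ler_pdivrMr// -natrM !ler_nat.
  by case: leqP.
pose N := (Num.truncn e).+1.
have eN : e <= N%:R by rewrite ltW// truncnS_gt.
exists (comb s e N), (comb' s e N); split; first exact: H10_density_comb.
move=> x x0; rewrite (Bop_comb s0 se)//.
have m0 := bump_prim_gt0 s0 se.
have s1 : -1 <= s by rewrite (le_trans _ s0)// lerN10.
split => [|xs|ex].
- rewrite subr_ge0 ler_pdivrMr// mul1r lerBlDr lerDl divr_ge0 ?(ltW m0)//.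
    have [xe|/ltW ex] := leP x e; rewrite andbT; last by rewrite bump_prim_right.
    by rewrite bump_prim_nondecreasing// (le_trans _ x0)// lerN10.
  by apply: Rintegral_ge0 => t _; exact: bump_ge0.
- by rewrite bump_prim_left// mul0r subr0.
- by rewrite (@bump_prim_right _ s e s0 se x)// divff ?subrr// gt_eqF.
Qed.

(** * Derivatives as limits along the steps 1/(n+1) *)

Lemma harmonic_dnbhs (R : realType) : (@harmonic R) n @[n --> \oo] --> (0 : R)^'.
Proof.
move=> A A0.
have H : \forall n \near \oo, @harmonic R n != 0 -> A (harmonic n) := @cvg_harmonic R _ A0.
have : \forall n \near \oo, A (@harmonic R n).
  by apply: filterS H => n; apply; rewrite gt_eqF// harmonic_gt0.
by [].
Qed.

Lemma is_derive_harmonic (R : realType) (h : R -> R) (D : R) : is_derive (0 : R) 1 h D ->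
  (harmonic n)^-1 * (h (harmonic n) - h 0) @[n --> \oo] --> D.
Proof.
move=> [dh <-].
have H := @cvg_comp _ _ _ harmonic
  (fun t : R => t^-1 *: (h (t *: (1 : R) + 0) - h 0)) _ _ _ (@harmonic_dnbhs R) dh.
apply: cvg_trans H; apply: near_eq_cvg; apply: nearW => n.
by rewrite /= /GRing.scale/= mulr1 addr0.
Qed.

(** * Linearity and Lipschitz bounds for the averaging operator *)

Section averaging.
Context (R : realType) (T : R) (T1 : 1 < T).
Local Notation mu := (@lebesgue_measure R).
Local Notation I := (`[0%R, T]%classic : set R).
Local Notation J := (`[0%R, T - 1]%classic : set R).

Lemma segment_shift_sub (x : R) : J x -> `[x, x + 1] `<=` I.
Proof.
rewrite /= in_itv/= => /andP[x0 xT] y; rewrite /= !in_itv/= => /andP[xy yx].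
by rewrite (le_trans x0)//= (le_trans yx)// -lerBrDr.
Qed.

Lemma BopD (w v : R -> R) (k x : R) : {within I, continuous w} -> {within I, continuous v} ->
  J x -> Bop (fun y => w y + k * v y) x = Bop w x + k * Bop v x.
Proof.
move=> cw cv Jx; rewrite /Bop /lebR.
have H f : {within I, continuous f} -> mu.-integrable `[x, x + 1] (EFin \o f).
  move=> /within_continuous_integrable; apply: integrableS => //.
  exact: segment_shift_sub.
rewrite RintegralD ?RintegralZl//; [exact: H|exact: H|].
by apply: integrable_realZ => //; exact: H.
Qed.

(** The average is V(x + 1) - V(x) for a primitive V of v, and V is Lipschitz since v is bounded. *)
Lemma Bop_lipschitz (v : R -> R) : {within I, continuous v} ->
  exists C, forall x y, J x -> J y -> `|Bop v x - Bop v y| <= C * `|x - y|.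
Proof.
move=> cv; have T0 : 0 <= T by rewrite ltW// (lt_trans ltr01).
have [M vM] := within_continuous_bounded T0 cv.
have iv := within_continuous_integrable cv.
pose V x := \int[mu]_(t in `[0, x]) v t.
have lipV := lipschitz_Rintegral iv vM.
have BV x : J x -> Bop v x = V (x + 1) - V x.
  rewrite /= in_itv/= => /andP[x0 xT]; rewrite /V (@Rintegral_segment_cat _ 0 x (x + 1))//.
  - by rewrite addrC addKr.
  - by rewrite lerDl.
  - by apply: integrableS iv => //; apply: subset_itvl; rewrite bnd_simp -lerBrDr.
have J1 x : J x -> I x /\ I (x + 1).
  rewrite /= !in_itv/= => /andP[x0 xT].
  by split; apply/andP; split; lra.
exists (M + M) => x y Jx Jy; have [Ix Ix1] := J1 _ Jx; have [Iy Iy1] := J1 _ Jy.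
rewrite !BV// (_ : _ - _ = (V (x + 1) - V (y + 1)) - (V x - V y)); last by ring.
apply: le_trans (ler_normB _ _) _; rewrite mulrDl lerD ?lipV//.
by apply: le_trans (lipV _ _ Ix1 Iy1) _; rewrite (_ : x + 1 - (y + 1) = x - y)//; ring.
Qed.

End averaging.

(** * The energy and its first variation *)

Section energy.
Context (R : realType) (T : R) (T0 : 0 < T) (a b : R -> R).
Hypotheses (haC1 : C1 a) (hbC1 : C1 b).
Local Notation mu := (@lebesgue_measure R).
Local Notation I := (`[0%R, T]%classic : set R).

Let mI : measurable I. Proof. exact: measurable_itv. Qed.
Let I_lty : (mu I < +oo)%E. Proof. exact: lebesgue_segment_lty. Qed.

Lemma C1_continuous (f : R -> R) : C1 f -> continuous f.
Proof.
move=> [df _] x; apply: differentiable_continuous.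
by rewrite -derivable1_diffP.
Qed.

Lemma C1_is_derive (f : R -> R) (x : R) : C1 f -> is_derive x 1 f (derive1 f x).
Proof. by move=> [df _]; rewrite derive1E; exact: DeriveDef. Qed.

Lemma within_comp (f w : R -> R) : continuous f -> {within I, continuous w} ->
  {within I, continuous (fun x => f (w x))}.
Proof. by move=> cf cw; apply: within_continuous_comp cw => x _; exact: cf. Qed.

Lemma translate_continuous (w gw : R -> R) :
  H10_density T (fun x => w x - 1) gw -> {within I, continuous w}.
Proof.
move=> /(density_continuous T0) cw.
have -> : w = (fun x => (w x - 1) + 1) by apply/funext => x; rewrite subrK.
by apply: (@within_continuousD _ _ _ _ (fun x => w x - 1) (cst 1)) => //; exact: cst_continuous.
Qed.

Definition energy_density (w gw : R -> R) (x : R) := a (w x) * gw x ^+ 2 + b (w x).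

Lemma energy_density_integrable (w gw : R -> R) : {within I, continuous w} ->
  square_integrable mu I gw -> mu.-integrable I (EFin \o energy_density w gw).
Proof.
move=> cw [mgw igw].
have caw := within_comp (C1_continuous haC1) cw.
have cbw := within_comp (C1_continuous hbC1) cw.
have [M aM] := within_continuous_bounded (ltW T0) caw.
have ib := within_continuous_integrable cbw.
have ia := @integrable_bounded_mul _ _ _ mu I mI _ _ _ (within_continuous_measurable caw) aM igw.
exact: (@integrable_realD _ _ _ mu I mI _ _ ia ib).
Qed.

Lemma Fenergy_density (w gw : R -> R) : H10_density T (fun x => w x - 1) gw ->
  Fenergy a b T w = (\int[mu]_(x in I) energy_density w gw x)%:E.
Proof.
move=> wgw; have cw := translate_continuous wgw.
have [N [mN N0 HN]] := density_ae_derive wgw.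
rewrite /Fenergy /lebR /Rintegral fineK; last first.
  apply: (@integrable_fin_num _ _ _ mu I mI _); apply: energy_density_integrable => //; by case: wgw.
(* The endpoints join the exceptional set because the derivative is identified only inside the
   interval. *)
apply: (@integral_eq_off_null _ _ _ mu I (N `|` ([set 0] `|` [set T]))).
- by apply: measurableU => //; apply: measurableU; exact: measurable_set1.
- apply: measure_negligible.
    by apply: measurableU => //; apply: measurableU; exact: measurable_set1.
  apply: negligibleU; first exact/negligibleP.
  by apply: negligibleU; apply/negligibleP;
    [exact: measurable_set1|exact: lebesgue_measure_set1|exact: measurable_set1|exact: lebesgue_measure_set1].
move=> x Ix H; have xT : `]0, T[%classic x.
  move: Ix; rewrite /= !in_itv/= => /andP[x0 xT].
  rewrite !lt_neqAle x0 xT !andbT; apply/andP; split; apply/eqP => E; apply: H; right.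
    by left.
  by right.
have dx : is_derive x 1 (fun x => w x - 1) (gw x) by apply: HN => // Nx; apply: H; left.
have dw : is_derive x 1 w (gw x).
  have -> : w = (fun x => (w x - 1) + 1) by apply/funext => y; rewrite subrK.
  by apply: is_derive_eq; rewrite addr0.
by rewrite /energy_density derive1E derive_val.
Qed.

Variables (u g0 : R -> R) (ug : H10_density T (fun x => u x - 1) g0).

Let cu : {within I, continuous u}. Proof. exact: translate_continuous ug. Qed.

(** With [source], these are the partial derivatives of a(u) p^2 + b(u) in p and in u, taken at p =
    g0, the density standing for u'. *)
Definition flux (x : R) := 2 * a (u x) * g0 x.
Definition source (x : R) := derive1 a (u x) * g0 x ^+ 2 + derive1 b (u x).
Definition first_variation (v g : R -> R) :=
  \int[mu]_(x in I) (flux x * g x + source x * v x).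

Lemma flux_square_integrable : square_integrable mu I flux.
Proof.
have ca : {within I, continuous (fun x => 2 * a (u x))}.
  apply: (@within_comp (fun y => 2 * a y)) => // y.
  by apply: cvgM; [exact: cvg_cst|exact: C1_continuous].
have [M aM] := within_continuous_bounded (ltW T0) ca.
have [g02 _] := ug.
exact: (@square_integrableMb _ _ _ mu I mI _ _ _ (within_continuous_measurable ca) aM g02).
Qed.

Lemma source_integrable : mu.-integrable I (EFin \o source).
Proof.
have ca := within_comp haC1.2 cu.
have cb := within_comp hbC1.2 cu.
have [M aM] := within_continuous_bounded (ltW T0) ca.
have [[_ g02] _] := ug.
have ia := @integrable_bounded_mul _ _ _ mu I mI _ _ _ (within_continuous_measurable ca) aM g02.
exact: (@integrable_realD _ _ _ mu I mI _ _ ia (within_continuous_integrable cb)).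
Qed.

Lemma first_variation_integrable (v g : R -> R) : H10_density T v g ->
  mu.-integrable I (EFin \o (fun x => flux x * g x + source x * v x)).
Proof.
move=> vg; have [M vM] := density_bounded T0 vg.
have isv := @integrable_bounded_mul _ _ _ mu I mI _ _ _ (density_measurable T0 vg) vM source_integrable.
have ifg : mu.-integrable I (EFin \o (fun x => flux x * g x)).
  by apply: square_integrableM => //; [exact: flux_square_integrable|case: vg].
apply: eq_integrable (@integrable_realD _ _ _ mu I mI _ _ ifg isv) => // x _ /=.
by rewrite (mulrC (v x)).
Qed.

Lemma first_variationD (v g w h : R -> R) : H10_density T v g -> H10_density T w h ->
  first_variation (fun x => v x + w x) (fun x => g x + h x) =
  first_variation v g + first_variation w h.
Proof.
move=> vg wh; rewrite /first_variation -RintegralD//.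
- by apply: eq_Rintegral => x _; ring.
- exact: first_variation_integrable.
- exact: first_variation_integrable.
Qed.

Lemma first_variationZ (k : R) (v g : R -> R) : H10_density T v g ->
  first_variation (fun x => k * v x) (fun x => k * g x) = k * first_variation v g.
Proof.
move=> vg; rewrite /first_variation -RintegralZl//.
- by apply: eq_Rintegral => x _; ring.
- exact: first_variation_integrable.
Qed.

Hypotheses (haL : glob_lipschitz a) (hbL : glob_lipschitz b).

Let energy_quotient (v g : R -> R) (n : nat) (x : R) :=
  (harmonic n)^-1 * (energy_density (fun y => u y + harmonic n * v y)
     (fun y => g0 y + harmonic n * g y) x - energy_density u g0 x).

Let cvg_energy_quotient (v g : R -> R) (x : R) :
  energy_quotient v g n x @[n --> \oo] --> flux x * g x + source x * v x.
Proof.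
pose h (s : R) := a (u x + s * v x) * (g0 x + s * g x) ^+ 2 + b (u x + s * v x).
have lin (al be : R) : is_derive (0 : R) 1 (fun s : R => al + s * be) be.
  by apply: is_derive_eq; rewrite /GRing.scale/=; ring.
have ca (f : R -> R) : C1 f -> is_derive (0 : R) 1 (fun s : R => f (u x + s * v x)) (derive1 f (u x) * v x).
  move=> fC1; have df : is_derive (u x + 0 * v x) 1 f (derive1 f (u x)).
    by rewrite mul0r addr0; exact: C1_is_derive.
  by have := @is_derive1_comp _ f (fun s : R => u x + s * v x) 0 _ _ df (lin _ _).
have dh : is_derive (0 : R) 1 h (flux x * g x + source x * v x).
  have da := ca _ haC1; have db := ca _ hbC1; have dl := lin (g0 x) (g x).
  apply: is_derive_eq; rewrite /flux /source /GRing.scale/= !mul0r !addr0; ring.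
have := is_derive_harmonic dh; apply: cvg_trans; apply: near_eq_cvg; apply: nearW => n.
by rewrite /h /energy_quotient /energy_density !mul0r !addr0.
Qed.

Let energy_quotient_bound (v g : R -> R) (Mv : R) : H10_density T v g ->
  (forall x, I x -> `|v x| <= Mv) ->
  exists2 G : R -> R, mu.-integrable I (EFin \o G) &
    forall n x, I x -> `|energy_quotient v g n x| <= G x.
Proof.
move=> vg vM.
have [La aL] := haL; have [Lb bL] := hbL.
have [M aM] := within_continuous_bounded (ltW T0) (within_comp (C1_continuous haC1) cu).
(* For steps s <= 1, both (g0 + s g)^2 and |2 g0 g + s g^2| are at most 2 (g0^2 + g^2); the
   Lipschitz constants bound the quotients of a and b. *)
exists (fun x => (2 * (`|La| * Mv) + 2 * M) * (g0 x ^+ 2 + g x ^+ 2) + `|Lb| * Mv).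
  have [[_ i0] _] := ug; have [[_ ig] _] := vg.
  have ic := @integrable_cst _ _ _ mu I mI I_lty (`|Lb| * Mv).
  apply: integrable_realD ic => //; apply: integrable_realZ => //.
  exact: integrable_realD.
move=> n x Ix; rewrite /energy_quotient /energy_density.
have s0 : 0 < harmonic n :> R by rewrite harmonic_gt0.
have s1 : harmonic n <= 1 :> R by rewrite /harmonic /= invf_le1// ler1n.
set s := harmonic n in s0 s1 *.
(* Obtained by adding and subtracting a(u) (g0 + s g)^2, which separates the variation of the
   coefficient from that of the square. *)
have -> : s^-1 * (a (u x + s * v x) * (g0 x + s * g x) ^+ 2 + b (u x + s * v x) -
     (a (u x) * g0 x ^+ 2 + b (u x))) =
   (s^-1 * (a (u x + s * v x) - a (u x))) * (g0 x + s * g x) ^+ 2 +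
   a (u x) * (2 * (g0 x * g x) + s * g x ^+ 2) + s^-1 * (b (u x + s * v x) - b (u x)).
  by field; rewrite gt_eqF.
have lip (f : R -> R) (L : R) : (forall x y, `|f x - f y| <= L * `|x - y|) ->
    `|s^-1 * (f (u x + s * v x) - f (u x))| <= `|L| * Mv.
  move=> fL; rewrite normrM gtr0_norm ?invr_gt0// ler_pdivrMl//.
  apply: le_trans (fL _ _) _; rewrite (_ : u x + _ - _ = s * v x); last by ring.
  rewrite normrM (gtr0_norm s0) mulrCA; apply: ler_wpM2l; first exact: ltW.
  apply: (@le_trans _ _ (`|L| * `|v x|)); first by rewrite ler_wpM2r// ler_norm.
  by rewrite ler_wpM2l// vM.
apply: le_trans (ler_normD _ _) _; apply: lerD; last exact: lip bL.
apply: le_trans (ler_normD _ _) _; rewrite [leRHS]mulrDl; apply: lerD; rewrite normrM.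
  rewrite -mulrA mulrCA; apply: ler_pM => //; first exact: lip aL.
  rewrite ger0_norm ?sqr_ge0//.
  have := sqr_ge0 (g0 x - s * g x); have : (s * g x) ^+ 2 <= g x ^+ 2.
    by rewrite exprMn ler_piMl ?sqr_ge0// exprn_ile1// ltW.
  by rewrite sqrrB sqrrD; lra.
rewrite -[leRHS]mulrA [leRHS]mulrCA; apply: ler_pM => //; first exact: aM.
have sg0 : 0 <= s * g x ^+ 2 by rewrite mulr_ge0 ?sqr_ge0 ?ltW.
have sg1 : s * g x ^+ 2 <= g x ^+ 2 by rewrite ler_piMl ?sqr_ge0.
have := sqr_ge0 (g0 x - g x); have := sqr_ge0 (g0 x + g x).
have := sqr_ge0 (g0 x); have := sqr_ge0 (g x).
by rewrite sqrrB sqrrD ler_norml => h1 h2 h3 h4; apply/andP; split; lra.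
Qed.

(** Dominated convergence carries the sign of the difference quotients to their limit. *)
Lemma first_variation_ge0 (v g : R -> R) : H10_density T v g ->
  (forall n, (Fenergy a b T u <= Fenergy a b T (fun x => u x + harmonic n * v x)%R)%E) ->
  0 <= first_variation v g.
Proof.
move=> vg hmin; have [Mv vM] := density_bounded T0 vg.
have [G iG Gq] := energy_quotient_bound vg vM.
have dens n : H10_density T (fun x => (u x + harmonic n * v x) - 1) (fun x => g0 x + harmonic n * g x).
  have -> : (fun x => (u x + harmonic n * v x) - 1) = (fun x => (u x - 1) + harmonic n * v x).
    by apply/funext => x; ring.
  by apply: H10_densityD => //; exact: H10_densityZ.
have ie0 : mu.-integrable I (EFin \o energy_density u g0).
  by apply: energy_density_integrable => //; case: ug.
have ien n : mu.-integrable I (EFin \o energy_density (fun y => u y + harmonic n * v y)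
     (fun y => g0 y + harmonic n * g y)).
  by apply: energy_density_integrable; [exact: translate_continuous (dens n)|case: (dens n)].
have iq n : mu.-integrable I (EFin \o energy_quotient v g n).
  by apply: integrable_realZ => //; exact: integrable_realB.
have q0 n : 0 <= \int[mu]_(x in I) energy_quotient v g n x.
  rewrite /energy_quotient RintegralZl//; last exact: integrable_realB.
  rewrite mulr_ge0 ?invr_ge0 ?(ltW (harmonic_gt0 _))// RintegralB// subr_ge0.
  by have := hmin n; rewrite (Fenergy_density ug) (Fenergy_density (dens n)) lee_fin.
have iv := first_variation_integrable vg.
have [||||_ _ lim] := @dominated_convergence _ _ _ mu I mI (fun n => EFin \o energy_quotient v g n)
  (EFin \o (fun x => flux x * g x + source x * v x)) (EFin \o G) _ _ _ iG.
- by move=> n; exact: (measurable_int mu (iq n)).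
- exact: (measurable_int mu iv).
- apply: aeW => x Ix; apply: cvg_EFin; first exact: nearW.
  exact: cvg_energy_quotient.
- by apply: aeW => x n Ix; rewrite /= lee_fin Gq.
rewrite -lee_fin /first_variation /Rintegral fineK; last exact: (@integrable_fin_num _ _ _ mu I mI _ iv).
rewrite -(cvg_lim _ lim)//; apply: lime_ge; first by apply/cvg_ex; eexists; exact: lim.
apply: nearW => n; rewrite -[leRHS]fineK ?lee_fin ?q0//.
exact: (@integrable_fin_num _ _ _ mu I mI _ (iq n)).
Qed.

End energy.

Lemma Rintegral_eq0_ae d (S : measurableType d) (R : realType)
    (m : {measure set S -> \bar R}) (D : set S) (f : S -> R) :
  measurable D -> m.-integrable D (EFin \o f) -> (forall x, D x -> 0 <= f x) ->
  \int[m]_(x in D) f x = 0 ->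
  exists N, [/\ measurable N, m N = 0%E & forall x, D x -> ~ N x -> f x = 0].
Proof.
move=> mD fi f0 if0.
have [N [mN N0 sN]] : ae_eq m D (EFin \o f) (cst 0%E).
  apply/(ae_eq_integral_abs m mD (measurable_int m fi)).
  transitivity (\int[m]_(x in D) (f x)%:E)%E.
    by apply: eq_integral => x /set_mem Dx; rewrite /= ger0_norm// f0.
  by rewrite -[LHS]fineK ?(integrable_fin_num mD fi)// -/(Rintegral m D f) if0.
exists N; split => // x Dx xN; apply: contrapT => fx; apply: xN; apply: sN => /=.
by move=> /(_ Dx) /= -[].
Qed.

Lemma measurable_prod_le (R : realType) (c : R) :
  measurable [set z : R * R | z.1 <= z.2 + c].
Proof.
have mf : measurable_fun setT (fun z : R * R => z.2 + c - z.1).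
  by apply: measurable_funB => //; apply: measurable_funD.
have := mf measurableT `[0, +oo[%classic (measurable_itv _).
rewrite setTI; congr (measurable _); apply/seteqP; split => z /=;
  by rewrite in_itv/= andbT subr_ge0.
Qed.

(** * The mass of [y-1, y] as the adjoint of averaging *)

Section window.
Context (R : realType) (T : R) (T1 : 1 < T) (Psi : cumulative R R).
Hypothesis Psi0 : forall x, x < 0 -> Psi x = 0.
Hypothesis PsiL : forall x, T - 1 <= x -> Psi x = Psi (T - 1).
Local Notation mu := (@lebesgue_measure R).
Local Notation nu := (lebesgue_stieltjes_measure Psi).
Local Notation I := (`[0%R, T]%classic : set R).
Local Notation J := (`[0%R, T - 1]%classic : set R).

Let L0 : 0 <= T - 1. Proof. by rewrite subr_ge0 ltW. Qed.

(** Written as an integral of 1, the form in which the inner integral comes out of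
    [fubini_section]. *)
Definition window (y : R) := \int[nu]_(x in J `&` `[y - 1, y]) (1 : R).

Let mJy (y : R) : measurable (J `&` `[y - 1, y]).
Proof. by apply: measurableI; exact: measurable_itv. Qed.

Let nu_J : nu J = (Psi (T - 1))%:E.
Proof. exact: stieltjes_segment. Qed.

Let nu_Jy_lty (y : R) : (nu (J `&` `[(y - 1)%R, y]) < +oo)%E.
Proof.
apply: (@le_lt_trans _ _ (nu J)); last by rewrite [X in (X < _)%E]nu_J ltry.
by apply: le_measure; rewrite ?inE//; exact: mJy.
Qed.

Let windowE (y : R) : (window y)%:E = nu (J `&` `[(y - 1)%R, y]).
Proof.
rewrite /window (Rintegral_cst nu (mJy y)) mul1r fineK//.
by rewrite ge0_fin_numE; [exact: nu_Jy_lty|exact: measure_ge0].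
Qed.

Lemma window_measure (y : R) : nu `[y - 1, y] = (window y)%:E.
Proof.
rewrite windowE setIC.
apply: etrans (@measureDI _ _ _ nu `[y - 1, y]%classic J _ _) _ => //.
rewrite -[RHS]add0e; congr (_ + _)%E.
apply/eqP; rewrite -measure_le0 -(stieltjes_off_segment Psi0 PsiL) le_measure ?inE//.
- exact: measurableD.
- exact: measurableC.
Qed.

Lemma window_bounds (y : R) : 0 <= window y <= Psi (T - 1).
Proof.
apply/andP; split; first exact: Rintegral_ge0.
by rewrite -lee_fin windowE -nu_J; apply: le_measure; rewrite ?inE//; exact: mJy.
Qed.

Lemma window_fubini (v : R -> R) : mu.-integrable I (EFin \o v) ->
  \int[nu]_(x in J) Bop v x = \int[mu]_(y in I) (v y * window y) /\
  mu.-integrable I (EFin \o (fun y => v y * window y)).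
Proof.
move=> iv.
(* The strip x <= y <= x + 1 has slices [x, x+1] and [y-1, y]; the [+ 0] matches
   [measurable_prod_le]. *)
pose E : set (R * R) := [set z | z.1 <= z.2 + 0] `&` [set z | z.2 <= z.1 + 1].
have mE : measurable E.
  apply: measurableI; first exact: measurable_prod_le.
  have := @measurable_prod_le R 1 => mle.
  have msw : measurable_fun setT (fun z : R * R => (z.2, z.1)) by exact: measurable_swap.
  by have := msw measurableT _ mle; rewrite setTI.
have i1 : nu.-integrable J (EFin \o (fun=> 1)).
  by apply: integrable_cst; [exact: measurable_itv|rewrite [X in (X < _)%E]nu_J ltry].
have [H1 H2] := @fubini_section _ _ _ _ _ nu mu J I E (measurable_itv _) (measurable_itv _) mE
  (fun=> 1) v i1 iv.
have windowE' y : v y * \int[nu]_(x in J `&` ysection E y) 1 = v y * window y.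
  congr (_ * Rintegral _ (_ `&` _) _).
  apply/seteqP; split => x; rewrite /ysection/= inE /E/= in_itv/= addr0.
    by move=> [xy yx]; rewrite xy andbT lerBlDr.
  by move=> /andP[]; rewrite lerBlDr.
split; last by apply: eq_integrable H2 => // y _; rewrite /= windowE'.
transitivity (\int[mu]_(y in I) (v y * \int[nu]_(x in J `&` ysection E y) 1)); last first.
  by apply: eq_Rintegral => y _; exact: windowE'.
rewrite -H1; apply: eq_Rintegral => x /set_mem Jx; rewrite mul1r /Bop /lebR.
congr (Rintegral _ _ _).
apply/seteqP; split => y; last first.
  by move=> [_]; rewrite /xsection/= inE /E/= in_itv/= addr0 => -[-> ->].
move=> xy; split; first exact: segment_shift_sub Jx _ xy.
by move: xy; rewrite /xsection/= inE /E/= in_itv/= addr0 => /andP[].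
Qed.

(** Fubini with v = 1 also supplies the measurability. *)
Lemma window_integrable : mu.-integrable I (EFin \o window).
Proof.
have i1 : mu.-integrable I (EFin \o (fun=> 1)).
  by apply: integrable_cst; [exact: measurable_itv|exact: lebesgue_segment_lty].
have [_] := window_fubini i1.
by under [X in EFin \o X]eq_fun do rewrite mul1r.
Qed.

End window.

(** * The lemma of du Bois-Reymond with an integrable lower-order term *)

Section du_bois_reymond.
Context (R : realType) (T : R) (T0 : 0 < T) (p k : R -> R).
Local Notation mu := (@lebesgue_measure R).
Local Notation I := (`[0%R, T]%classic : set R).
Hypotheses (p2 : square_integrable mu I p) (ik : mu.-integrable I (EFin \o k)).
Hypothesis weak : forall v g, H10_density T v g ->
  \int[mu]_(x in I) (p x * g x + k x * v x) = 0.

Let mI : measurable I. Proof. exact: measurable_itv. Qed.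
Let I_lty : (mu I < +oo)%E. Proof. exact: lebesgue_segment_lty. Qed.
Let K (x : R) := \int[mu]_(t in `[0, x]) k t.

Let cK : {within I, continuous K}.
Proof. exact: (parameterized_integral_continuous (ltW T0) ik). Qed.

(** Fubini on the triangle y <= x acts as an integration by parts. It asks no more of k than
    integrability, which matters because [source] contains the square of an L^2 function. *)
Lemma Rintegral_triangle (g : R -> R) : mu.-integrable I (EFin \o g) ->
  \int[mu]_(x in I) (k x * \int[mu]_(y in `[0, x]) g y) =
  \int[mu]_(y in I) (g y * (K T - K y)).
Proof.
move=> ig; pose E : set (R * R) := [set z | z.2 <= z.1 + 0].
have mE : measurable E.
  have msw : measurable_fun setT (fun z : R * R => (z.2, z.1)) by exact: measurable_swap.
  by have := msw measurableT _ (@measurable_prod_le R 0); rewrite setTI.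
have [+ _] := @fubini_section _ _ _ _ _ mu mu I I E mI mI mE k g ik ig.
move=> H; transitivity (\int[mu]_(x in I) (k x * \int[mu]_(y in I `&` xsection E x) g y)).
  apply: eq_Rintegral => x /set_mem Ix; congr (_ * Rintegral _ _ _).
  move: Ix; rewrite /= in_itv/= => /andP[x0 xT].
  apply/seteqP; split => y; rewrite /xsection/= inE /E/= !in_itv/= addr0.
    by move=> /andP[-> yx]; rewrite (le_trans yx).
  by move=> [/andP[-> _] ->].
rewrite H; apply: eq_Rintegral => y /set_mem Iy; congr (_ * _).
move: Iy; rewrite /= in_itv/= => /andP[y0 yT].
rewrite /K (@Rintegral_segment_cat _ 0 y T k)// [RHS]addrC addKr.
congr (Rintegral _ _ _).
apply/seteqP; split => x; rewrite /ysection/= inE /E/= !in_itv/= addr0.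
  by move=> [/andP[_ ->] ->].
by move=> /andP[yx ->]; rewrite yx (le_trans y0 yx).
Qed.

(** The weak equation is tested with the density g = p - K - c itself. As g has mean zero, the
    constants K(T) and c drop out and the integral of g^2 is zero. *)
Lemma du_bois_reymond : exists c N, [/\ measurable N, mu N = 0%E &
  forall x, I x -> ~ N x -> p x = \int[mu]_(t in `[0, x]) k t + c].
Proof.
have mK := within_continuous_measurable cK.
have [MK KM] := within_continuous_bounded (ltW T0) cK.
have K2 : square_integrable mu I K.
  exact: (@square_integrable_bounded _ _ _ mu I mI I_lty _ MK mK KM).
pose w x := p x + -1 * K x.
have w2 : square_integrable mu I w.
  by apply: square_integrableD => //; apply: square_integrableZ.
have iw : mu.-integrable I (EFin \o w) by exact: square_integrable_int.
(* The mean of w, so that the primitive of g returns to 0 at T and is an admissible test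
   function. *)
pose c := (\int[mu]_(x in I) w x) / T.
pose g x := w x - c.
have ic : mu.-integrable I (EFin \o cst c) by exact: integrable_cst.
have g2 : square_integrable mu I g.
  apply: square_integrableD => //.
  by apply: (@square_integrable_bounded _ _ _ mu I mI I_lty _ `|- c|).
have ig : mu.-integrable I (EFin \o g) by exact: square_integrable_int.
have g_mean0 : \int[mu]_(x in I) g x = 0.
  rewrite /g RintegralB// Rintegral_cst// /c.
  have -> : fine (mu I) = T.
    by rewrite lebesgue_measure_itv/= lte_fin T0/= subr0.
  by rewrite divfK ?subrr// gt_eqF.
pose v x := \int[mu]_(t in `[0, x]) g t.
have vg : H10_density T v g by split => //; split.
have E := weak vg.
have [Mv vM] := density_bounded T0 vg.
have ikv : mu.-integrable I (EFin \o (fun x => k x * v x)).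
  have := @integrable_bounded_mul _ _ _ mu I mI _ _ _ (density_measurable T0 vg) vM ik.
  by apply: eq_integrable => // x _ /=; rewrite mulrC.
have ipg : mu.-integrable I (EFin \o (fun x => p x * g x)) by exact: square_integrableM.
have igK : mu.-integrable I (EFin \o (fun x => g x * (K T - K x))).
  have K2' : square_integrable mu I (fun x => K T - K x).
    have K2n : square_integrable mu I (fun x => -1 * K x) by exact: square_integrableZ.
    have cT : square_integrable mu I (cst (K T)).
      by apply: (@square_integrable_bounded _ _ _ mu I mI I_lty _ `|K T|).
    have -> : (fun x => K T - K x) = (fun x => K T + -1 * K x).
      by apply/funext => x; rewrite mulN1r.
    exact: square_integrableD.
  exact: square_integrableM.
have gg0 : \int[mu]_(x in I) (g x ^+ 2) = 0.
  transitivity (\int[mu]_(x in I) ((p x * g x + g x * (K T - K x)) + (- (K T + c)) * g x)).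
    by apply: eq_Rintegral => x _; rewrite /g /w; ring.
  rewrite RintegralD//; last 2 first.
  - exact: integrable_realD.
  - exact: integrable_realZ.
  rewrite RintegralZl// g_mean0 mulr0 addr0 RintegralD//.
  by rewrite -Rintegral_triangle// -RintegralD.
have [N [mN N0 HN]] := @Rintegral_eq0_ae _ _ _ mu I _ mI g2.2 (fun x _ => sqr_ge0 (g x)) gg0.
exists c, N; split => // x Ix xN; have /eqP := HN x Ix xN.
rewrite sqrf_eq0 /g /w mulN1r => /eqP; rewrite -/(K x); lra.
Qed.

End du_bois_reymond.

(* [lebesgue_stieltjes_measure] lives on the generated sigma-algebra over
   [ocitv]; this is the same set function on the Borel structure of [R]. *)
Section stieltjes_borel.
Context (R : realType) (Psi : cumulative R R).

Definition stieltjes_borel (A : set R) : \bar R := lebesgue_stieltjes_measure Psi A.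

Let borel0 : stieltjes_borel set0 = 0%E.
Proof. exact: measure0. Qed.

Let borel_ge0 A : (0 <= stieltjes_borel A)%E.
Proof. exact: measure_ge0. Qed.

Let borel_sigma_additive : semi_sigma_additive stieltjes_borel.
Proof. exact: (@measure_semi_sigma_additive _ _ _ (lebesgue_stieltjes_measure Psi)). Qed.

HB.instance Definition _ := isMeasure.Build _ R R stieltjes_borel
  borel0 borel_ge0 borel_sigma_additive.

End stieltjes_borel.

(** * The obstacle multiplier and the regularity of a minimizer *)

Section minimizer.
Context (R : realType) (T : R) (T1 : 1 < T) (a b : R -> R) (a0 : R).
Hypotheses (haC1 : C1 a) (hbC1 : C1 b).
Hypotheses (haL : glob_lipschitz a) (hbL : glob_lipschitz b).
Hypotheses (a0_gt0 : 0 < a0) (age : forall x, a0 <= a x).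
Variables (u g0 : R -> R) (ug : H10_density T (fun x => u x - 1) g0).
Local Notation mu := (@lebesgue_measure R).
Local Notation I := (`[0%R, T]%classic : set R).
Local Notation J := (`[0%R, T - 1]%classic : set R).

Let T0 : 0 < T. Proof. exact: lt_trans T1. Qed.
Let L0 : 0 < T - 1. Proof. by rewrite subr_gt0. Qed.
Let mI : measurable I. Proof. exact: measurable_itv. Qed.
Let I_lty : (mu I < +oo)%E. Proof. exact: lebesgue_segment_lty. Qed.
Let cu : {within I, continuous u}. Proof. exact: (translate_continuous T0 ug). Qed.

Section multiplier.
Hypothesis u_ge0 : forall x, J x -> 0 <= Bop u x.
Hypothesis umin : forall w, inK T w -> (Fenergy a b T u <= Fenergy a b T w)%E.
Local Notation Lam := (first_variation T a b u g0).

Lemma first_variation_admissible (v g : R -> R) : H10_density T v g ->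
  (forall n x, J x -> 0 <= Bop u x + harmonic n * Bop v x) -> 0 <= Lam v g.
Proof.
move=> vg Bv; apply: first_variation_ge0 => // n; apply: umin; split.
  apply/H10P; exists (fun x => g0 x + harmonic n * g x).
  have -> : (fun x => u x + harmonic n * v x - 1) = (fun x => (u x - 1) + harmonic n * v x).
    by apply/funext => x; ring.
  by apply: H10_densityD => //; exact: H10_densityZ.
move=> x Jx; rewrite (BopD _ cu _ Jx) ?Bv//.
exact: density_continuous vg.
Qed.

(** Agreement is asked only on J: for other x, [Bop v x] involves values of v outside [0, T], on
    which [H10_density] says nothing. *)
Let P (p : R -> R) (l : R) := exists v g, [/\ H10_density T v g,
  forall x, J x -> p x = Bop v x & l = Lam v g].

Lemma multiplier_exists : exists Psi : cumulative R R,
  [/\ forall x, x < 0 -> Psi x = 0, forall x, T - 1 <= x -> Psi x = Psi (T - 1) &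
  forall v g, H10_density T v g ->
    \int[lebesgue_stieltjes_measure Psi]_(x in J) Bop v x = Lam v g].
Proof.
have PD p l q m : P p l -> P q m -> P (fun x => p x + q x) (l + m).
  move=> [v [g [vg pv ->]]] [w [h [wh qw ->]]].
  exists (fun x => v x + w x), (fun x => g x + h x).
  split; [exact: H10_densityD| |by rewrite (first_variationD T0 haC1 hbC1 ug vg wh)].
  move=> x Jx; rewrite pv// qw//.
  have := BopD 1 (density_continuous T0 vg) (density_continuous T0 wh) Jx.
  by rewrite mul1r => <-; congr (Bop _ x); apply/funext => y; rewrite mul1r.
have PZ k p l : P p l -> P (fun x => k * p x) (k * l).
  move=> [v [g [vg pv ->]]]; exists (fun x => k * v x), (fun x => k * g x).
  split; [exact: H10_densityZ| |by rewrite (first_variationZ T0 haC1 hbC1 ug k vg)].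
  move=> x Jx; rewrite pv//.
  have c0 : {within I, continuous (cst 0 : R -> R)}.
    by apply: continuous_subspaceT => ?; exact: cst_continuous.
  have := BopD k c0 (density_continuous T0 vg) Jx.
  rewrite [X in _ = X + _]/Bop Rintegral_cst// mul0r add0r => <-.
  by congr (Bop _ x); apply/funext => y; rewrite add0r.
have P_ge0 p l : P p l -> (forall x, J x -> 0 <= p x) -> 0 <= l.
  move=> [v [g [vg pv ->]]] p0; apply: first_variation_admissible vg _ => n x Jx.
  by rewrite addr_ge0 ?u_ge0// mulr_ge0 ?(ltW (harmonic_gt0 _))// -pv// p0.
have P_lip p l : P p l -> exists C, forall x y, J x -> J y -> `|p x - p y| <= C * `|x - y|.
  move=> [v [g [vg pv _]]]; have [C BC] := Bop_lipschitz T1 (density_continuous T0 vg).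
  by exists C => x y Jx Jy; rewrite !pv// BC.
have P_cut (n i : nat) : (1 < n)%N -> i.+1%:R / n%:R <= (T - 1) + 1 ->
    exists p l, P p l /\ forall x, J x -> [/\ 0 <= p x <= 1,
    x <= i%:R / n%:R -> p x = 1 & i.+1%:R / n%:R <= x -> p x = 0].
  rewrite subrK => n1 iT; have [v [g [vg Bv]]] := cutoff_exists n1 iT.
  exists (Bop v), (Lam v g); split; first by exists v, g.
  by move=> x; rewrite /= in_itv/= => /andP[x0 _]; exact: Bv.
have [Psi [Psi0 PsiL HP]] := positive_functional_stieltjes L0 PD PZ P_ge0 P_lip P_cut.
exists Psi; split; [exact: Psi0|exact: PsiL|].
by move=> v g vg; apply: HP; exists v, g.
Qed.

(* Comparing with [w = 1 - v1], where [B v1 = 1], gives [B w = 0]: both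
   directions [u - w] and [w - u] are admissible at [u]. *)
Lemma complementary_slackness (Psi : cumulative R R) :
  (forall v g, H10_density T v g ->
    \int[lebesgue_stieltjes_measure Psi]_(x in J) Bop v x = Lam v g) ->
  \int[lebesgue_stieltjes_measure Psi]_(x in J) Bop u x = 0.
Proof.
(* On the grid of mesh 1/2 there is a cutoff ending before T whose average is 1 on all of J. *)
move=> HP; have [Li iL] := grid_bound L0 (isT : (1 < 2)%N).
rewrite subrK in iL; have [v1 [g1 [vg1 Bv1]]] := cutoff_exists (isT : (1 < 2)%N) iL.
(* This direction is (u - 1) + v1 = u - w; it vanishes at both ends and has the same average as u on
   J. *)
have vg := H10_densityD ug vg1.
set v := (fun x => _ + _) in vg; set g := (fun x => _ + _) in vg.
have cv1 := density_continuous T0 vg1.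
have Bv x : J x -> Bop v x = Bop u x.
  move=> Jx; have c1 : {within I, continuous (cst 1 : R -> R)}.
    by apply: continuous_subspaceT => ?; exact: cst_continuous.
  have E1 := BopD (-1) cv1 c1 Jx.
  have c2 : {within I, continuous (fun y => v1 y + -1 * cst 1 y)}.
    by apply: (@within_continuousD _ _ _ _ v1 (fun=> -1 * 1)) => //;
      apply: continuous_subspaceT => ?; exact: cst_continuous.
  have E2 := BopD 1 cu c2 Jx.
  have -> : v = (fun y => u y + 1 * (v1 y + -1 * cst 1 y)).
    by apply/funext => y; rewrite /v /=; ring.
  rewrite E2 E1; have : Bop v1 x = 1.
    have /andP[x0 xL] : 0 <= x <= T - 1 by move: Jx; rewrite /= in_itv/=.
    by have [_ + _] := Bv1 x x0; apply; exact: le_trans Li.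
  have -> : Bop (cst 1) x = 1.
    rewrite /Bop /lebR Rintegral_cst//= lebesgue_measure_itv/= lte_fin ltrDl ltr01/=.
    by rewrite mul1r addrAC subrr add0r.
  by move=> ->; ring.
transitivity (\int[lebesgue_stieltjes_measure Psi]_(x in J) Bop v x).
  by apply: eq_Rintegral => x /set_mem Jx; rewrite Bv.
rewrite (HP _ _ vg); apply/eqP; rewrite eq_le; apply/andP; split.
  rewrite -oppr_ge0 -mulN1r -(first_variationZ T0 haC1 hbC1 ug (-1) vg).
  apply: first_variation_admissible; first exact: H10_densityZ.
  move=> n x Jx.
  have c0 : {within I, continuous (cst 0 : R -> R)}.
    by apply: continuous_subspaceT => ?; exact: cst_continuous.
  have -> : Bop (fun y => -1 * v y) x = - Bop u x.
    have := BopD (-1) c0 (density_continuous T0 vg) Jx.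
    rewrite [X in _ = X + _]/Bop Rintegral_cst// mul0r add0r mulN1r Bv// => <-.
    by congr (Bop _ x); apply/funext => y; rewrite add0r.
  (* The average along w - u is (1 - 1/(n+1)) B u, nonnegative because the step is at most 1. *)
  rewrite mulrN -[X in X - _]mul1r -mulrBl mulr_ge0 ?u_ge0// subr_ge0.
  by rewrite /harmonic/= invf_le1// ler1n.
apply: first_variation_admissible => // n x Jx; rewrite Bv//.
by rewrite addr_ge0 ?mulr_ge0 ?u_ge0// ltW// harmonic_gt0.
Qed.

(** Since B u >= 0 integrates to zero, it vanishes almost everywhere on J for the multiplier. Around
    a point of J off the contact set, continuity keeps B u positive, so a small ball is null; around
    a point off J, a small ball misses J. *)
Lemma multiplier_support (Psi : cumulative R R) :
  (forall x, x < 0 -> Psi x = 0) -> (forall x, T - 1 <= x -> Psi x = Psi (T - 1)) ->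
  \int[lebesgue_stieltjes_measure Psi]_(x in J) Bop u x = 0 ->
  msupport (stieltjes_borel Psi) `<=` contact_set T u.
Proof.
move=> Psi0 PsiL Bu0; set nu := lebesgue_stieltjes_measure Psi.
have [C BC] := Bop_lipschitz T1 cu.
have BC' x y : J x -> J y -> `|Bop u x - Bop u y| <= (`|C| + 1) * `|x - y|.
  move=> Jx Jy; apply: le_trans (BC _ _ Jx Jy) _.
  by rewrite ler_wpM2r// (le_trans (ler_norm _))// lerDl.
have C1 : 0 < `|C| + 1 by rewrite ltr_wpDl.
have cB : {within J, continuous (Bop u)}.
  apply/subspace_continuousP => x Jx; apply/cvgrPdist_le => e e0.
  near=> y; have Jy : J y by near: y; exact: withinT.
  apply: le_trans (BC' _ _ Jx Jy) _.
  rewrite -ler_pdivlMl// mulrC; near: y; apply: cvg_within.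
  by apply: filterS (nbhsx_ballx x _ (divr_gt0 e0 C1)) => y /ltW.
have mJ : measurable J by exact: measurable_itv.
have [M BM] := within_continuous_bounded (ltW L0) cB.
have iB : nu.-integrable J (EFin \o Bop u).
  apply: (@integrable_bounded _ _ _ nu J mJ _ _ M) => //.
    by rewrite [X in (X < _)%E](stieltjes_segment (ltW L0) Psi0 PsiL) ltry.
  exact: within_continuous_measurable.
have [N [mN N0 HN]] := @Rintegral_eq0_ae _ _ _ nu J _ mJ iB u_ge0 Bu0.
move=> x xs; apply: contrapT => xc.
suff [e e0 He] : exists2 e, 0 < e & forall y, ball x e y -> J y -> Bop u y != 0.
  suff Z : nu (ball x e) = 0%E by have := xs e e0; rewrite [X in (_ < X)%E]Z ltxx.
  apply: measure_negligible; first exact: measurable_ball.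
  apply: (@negligibleS _ _ _ nu (~` J `|` N)).
    move=> y xy; have [Jy|nJy] := pselect (J y); last by left.
    right; apply: contrapT => yN; have := He y xy Jy.
    by rewrite HN// eqxx.
  apply: negligibleU; apply/negligibleP => //; first exact: measurableC.
  exact: stieltjes_off_segment.
have [Jx|nJx] := pselect (J x).
  have Bx : Bop u x != 0 by apply/eqP => E; apply: xc.
  have Bx0 : 0 < Bop u x by rewrite lt_def Bx u_ge0.
  exists (Bop u x / (`|C| + 1)); first by rewrite divr_gt0.
  move=> y; rewrite /ball/= ltr_pdivlMr// mulrC => xy Jy.
  have := le_lt_trans (BC' _ _ Jx Jy) xy; rewrite ltr_norml => /andP[_ h].
  by rewrite gt_eqF//; move: h; rewrite ltrBlDr ltrDl.
have : open (~` J) by apply: closed_openC; exact: interval_closed.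
move=> /(_ x nJx) /nbhs_ballP[e /= e0 He]; exists e => // y /He nJy Jy; by exfalso.
Unshelve. all: by end_near. Qed.

End multiplier.

(** * W^{2,oo} regularity and the Euler equation for a bounded right-hand side *)

Section regularity.
Variables (h : R -> R) (H : R).
Hypotheses (ih : mu.-integrable I (EFin \o h)) (h_bound : forall x, I x -> `|h x| <= H).
Hypothesis euler : forall v g, H10_density T v g ->
  first_variation T a b u g0 v g = \int[mu]_(x in I) (v x * h x).

Let k x := source a b u g0 x - h x.

Let ik : mu.-integrable I (EFin \o k).
Proof. by apply: integrable_realB => //; exact: source_integrable. Qed.

Let flux_primitive : exists c N, [/\ measurable N, mu N = 0%E &
  forall x, I x -> ~ N x -> flux a u g0 x = \int[mu]_(t in `[0, x]) k t + c].
Proof.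
apply: du_bois_reymond => //; first exact: (flux_square_integrable T0 haC1 ug).
move=> v g vg; have E := euler vg.
have iv := first_variation_integrable T0 haC1 hbC1 ug vg.
have [M vM] := density_bounded T0 vg.
have ihv : mu.-integrable I (EFin \o (fun x => v x * h x)).
  exact: (@integrable_bounded_mul _ _ _ mu I mI _ _ _ (density_measurable T0 vg) vM ih).
transitivity (\int[mu]_(x in I) ((flux a u g0 x * g x + source a b u g0 x * v x) - v x * h x)).
  by apply: eq_Rintegral => x _; rewrite /k; ring.
by rewrite RintegralB// -/(first_variation T a b u g0 v g) E subrr.
Qed.

(** Dividing the flux identity by 2 a(u) gives a continuous representative r of u', so u is C^1.
    With r in place of g0, the right-hand side becomes bounded and its primitive W Lipschitz; hence
    r is Lipschitz too. *)
Lemma minimizer_regular : W2inf T u /\ exists N, [/\ measurable N, mu N = 0%E &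
  forall x, `]0, T[%classic x -> ~ N x ->
    - 2 * a (u x) * derive1 (derive1 u) x - derive1 a (u x) * (derive1 u x) ^+ 2
         + derive1 b (u x) = h x].
Proof.
have a_gt0 x : 0 < a x by exact: lt_le_trans (age x).
have [c [N [mN N0 HN]]] := flux_primitive.
pose W x := \int[mu]_(t in `[0, x]) k t.
pose r x := (W x + c) / (2 * a (u x)).
have g0r x : I x -> ~ N x -> g0 x = r x.
  move=> Ix xN; rewrite /r /W -(HN x Ix xN) /flux; field; rewrite ?gt_eqF//.
have cW : {within I, continuous W}.
  exact: (parameterized_integral_continuous (ltW T0) ik).
have cau : {within I, continuous (fun x => a (u x))}.
  exact: within_comp (C1_continuous haC1) cu.
have cr : {within I, continuous r}.
  move=> x; apply: cvgM.
    by apply: cvgD; [exact: cW|exact: cvg_cst].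
  apply: cvgV; first by rewrite mulf_neq0 ?gt_eqF.
  by apply: cvgM; [exact: cvg_cst|exact: cau].
have ir := within_continuous_integrable cr.
have ur x : I x -> u x = 1 + \int[mu]_(t in `[0, x]) r t.
  move=> Ix; apply/eqP; rewrite addrC -subr_eq (ug.2.1 _ Ix); apply/eqP.
  rewrite /Rintegral; congr fine; apply: (integral_eq_off_null mN N0) => t + tN.
  move: Ix; rewrite /= !in_itv/= => /andP[_ xT] /andP[t0 tx].
  by rewrite g0r//= in_itv/= t0 (le_trans tx).
have du x : `]0, T[%classic x -> is_derive x 1 u (r x).
  move=> xT; have := xT; rewrite /= in_itv/= => /andP[x0 xT'].
  have crx : {for x, continuous r}.
    by apply: (within_continuous_continuous T0 cr); rewrite in_itv/= x0.
  have [dF Ff] := continuous_FTC1_closed xT' ir x0 crx.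
  pose G (y : R) := \int[mu]_(t in `[0, y]) r t.
  have dG : is_derive x 1 G (r x) by rewrite -Ff derive1E; exact: DeriveDef.
  have {}dG : is_derive x 1 (cst 1 + G) (r x) by rewrite -[r x]add0r; exact: is_deriveD.
  apply: near_eq_is_derive dG; near=> y; rewrite ur//.
  have : `]0, T[%classic y by near: y; exact: near_in_itvoo.
  by rewrite /= !in_itv/= => /andP[/ltW -> /ltW ->].
have u'r x : `]0, T[%classic x -> derive1 u x = r x.
  by move=> /du dux; rewrite derive1E derive_val.
pose sg x := derive1 a (u x) * r x ^+ 2 + derive1 b (u x).
have csg : {within I, continuous sg}.
  have ca' := within_comp haC1.2 cu; have cb' := within_comp hbC1.2 cu.
  move=> x; apply: cvgD; last exact: cb'.
  apply: cvgM; first exact: ca'.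
  by rewrite expr2; apply: cvgM; exact: cr.
(* Equal to k off N, but bounded because r replaces g0; this upgrades W from absolutely continuous
   to Lipschitz. *)
pose k' x := sg x - h x.
have ik' : mu.-integrable I (EFin \o k').
  by apply: integrable_realB => //; exact: within_continuous_integrable.
have Wk' x : I x -> W x = \int[mu]_(t in `[0, x]) k' t.
  move=> Ix; rewrite /W /Rintegral; congr fine; apply: (integral_eq_off_null mN N0) => t + tN.
  move: Ix; rewrite /= !in_itv/= => /andP[_ xT] /andP[t0 tx].
  by rewrite /k /k' /sg /source g0r//= in_itv/= t0 (le_trans tx).
have [Ms sM] := within_continuous_bounded (ltW T0) csg.
have [Mr rM] := within_continuous_bounded (ltW T0) cr.
have [La aL] := haL.
have k'M x : I x -> `|k' x| <= Ms + H.
  by move=> Ix; rewrite (le_trans (ler_normB _ _))// lerD ?sM ?h_bound.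
have lipW x y : I x -> I y -> `|W x - W y| <= (Ms + H) * `|x - y|.
  by move=> Ix Iy; rewrite !Wk'//; exact: (lipschitz_Rintegral ik' k'M).
have lipu x y : I x -> I y -> `|u x - u y| <= Mr * `|x - y|.
  move=> Ix Iy; rewrite !ur// opprD addrACA subrr add0r.
  exact: (lipschitz_Rintegral ir rM).
(* Follows from 2 a(u) r = W + c at both points; the single denominator is at least 2 a0. *)
have rE x y : r x - r y = ((W x - W y) + 2 * r y * (a (u y) - a (u x))) / (2 * a (u x)).
  by rewrite /r; field; rewrite !gt_eqF.
pose C := ((Ms + H) + 2 * Mr * (`|La| * Mr)) / (2 * a0).
have lipr x y : I x -> I y -> `|r x - r y| <= C * `|x - y|.
  move=> Ix Iy; rewrite rE normrM normfV (gtr0_norm (_ : 0 < 2 * a (u x))) ?mulr_gt0//.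
  rewrite ler_pdivrMr ?mulr_gt0//.
  have Mr0 : 0 <= Mr by exact: le_trans (rM _ Ix).
  have num : `|W x - W y + 2 * r y * (a (u y) - a (u x))| <=
      (Ms + H + 2 * Mr * (`|La| * Mr)) * `|x - y|.
    apply: le_trans (ler_normD _ _) _; rewrite [leRHS]mulrDl; apply: lerD; first exact: lipW.
    rewrite normrM -[leRHS]mulrA; apply: ler_pM => //.
      by rewrite normrM ger0_norm// ler_wpM2l// rM.
    apply: le_trans (aL _ _) _; rewrite -[leRHS]mulrA.
    apply: (@le_trans _ _ (`|La| * `|u y - u x|)); first by rewrite ler_wpM2r// ler_norm.
    by rewrite ler_wpM2l// distrC lipu.
  apply: le_trans num _; rewrite /C.
  have -> : (Ms + H + 2 * Mr * (`|La| * Mr)) * `|x - y| =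
     ((Ms + H + 2 * Mr * (`|La| * Mr)) / (2 * a0) * `|x - y|) * (2 * a0).
    by field; rewrite gt_eqF.
  have H0 : 0 <= H by exact: le_trans (h_bound Ix).
  have Ms0 : 0 <= Ms by exact: le_trans (sM _ Ix).
  apply: ler_wpM2l; last by rewrite ler_wpM2l// age.
  apply: mulr_ge0 => //; apply: divr_ge0; last by rewrite mulr_ge0// ltW.
  by rewrite !addr_ge0 ?mulr_ge0.
have oo_cc x : `]0, T[%classic x -> I x by exact: subset_itv_oo_cc.
split.
  split; first by move=> x xT; have [] := du x xT.
  by exists C => x y xT yT; rewrite !u'r//; apply: lipr; exact: oo_cc.
(* Off this null set W has derivative k', and differentiating r = (W + c) / (2 a(u)) gives the Euler
   equation. *)
have [N' [mN' N'0 HN']] := Rintegral_ae_derive ik' Wk'.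
exists N'; split => // x xT xN'.
have dW := HN' x xT xN'; have dux := du x xT.
have dau : is_derive x 1 (fun y => a (u y)) (derive1 a (u x) * r x).
  exact: (@is_derive1_comp _ a u x _ _ (C1_is_derive (u x) haC1) dux).
have dr : is_derive x 1 r ((k' x - 2 * r x * (derive1 a (u x) * r x)) / (2 * a (u x))).
  have dden : is_derive x 1 (fun y => 2 * a (u y)) (2 * (derive1 a (u x) * r x)).
    by apply: is_derive_eq; rewrite /GRing.scale/=; ring.
  have dinv : is_derive x 1 (fun y => (2 * a (u y))^-1)
      (- (2 * a (u x)) ^- 2 *: (2 * (derive1 a (u x) * r x))).
    by apply: is_deriveV => //; rewrite mulf_neq0 ?gt_eqF.
  have dnum : is_derive x 1 (fun y => W y + c) (k' x).
    by apply: is_derive_eq; rewrite addr0.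
  have := is_deriveM dnum dinv; congr (is_derive x 1 _ _).
  rewrite /GRing.scale/= /r; field; rewrite gt_eqF//.
have -> : derive1 (derive1 u) x = (k' x - 2 * r x * (derive1 a (u x) * r x)) / (2 * a (u x)).
  rewrite derive1E; have := dr; rewrite -(near_eq_derive (f := r)).
    by move=> ?; rewrite derive_val.
  near=> y; rewrite u'r//; near: y; exact: near_in_itvoo.
rewrite u'r// /k' /sg; field; rewrite gt_eqF//.
Unshelve. all: by end_near. Qed.

End regularity.
End minimizer.

Theorem mainTheorem4 (R : realType) (T : R) (a b : R -> R) (a0 : R)
  (hT : 1 < T) (haC1 : C1 a) (hbC1 : C1 b)
  (haL : glob_lipschitz a) (hbL : glob_lipschitz b)
  (ha0 : 0 < a0) (hage : forall x, a0 <= a x)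
  (u : R -> R) (huK : inK T u)
  (hmin : forall w, inK T w -> (Fenergy a b T u <= Fenergy a b T w)%E) :
  W2inf T u /\
  exists f : {measure set R -> \bar R},
    radon_on_seg T f /\ msupport f `<=` contact_set T u /\
    {ae lebR, forall x, `]0, T[ x ->
       ((- 2 * a (u x) * derive1 (derive1 u) x - derive1 a (u x) * (derive1 u x) ^+ 2
         + derive1 b (u x))%:E = f `[x - 1, x])}.
Proof.
have [/H10P[g0 ug] u_ge0] := huK.
have T0 : 0 < T by exact: lt_trans hT.
have L0 : 0 < T - 1 by rewrite subr_gt0.
have [Psi [Psi0 PsiL HPsi]] := multiplier_exists hT haC1 hbC1 haL hbL ug u_ge0 hmin.
have slack := complementary_slackness hT haC1 hbC1 haL hbL ug u_ge0 hmin HPsi.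
have euler v g : H10_density T v g -> first_variation T a b u g0 v g =
    \int[lebesgue_measure]_(x in `[0, T]) (v x * window T Psi x).
  move=> vg; rewrite -(HPsi _ _ vg).
  by have [] := window_fubini hT Psi0 PsiL (within_continuous_integrable (density_continuous T0 vg)).
have hb x : `[0, T]%classic x -> `|window T Psi x| <= Psi (T - 1).
  by move=> _; have /andP[h0 h1] := window_bounds hT Psi0 PsiL x; rewrite ger0_norm.
have [W2 [N [mN N0 HN]]] := minimizer_regular hT haC1 hbC1 haL ha0 hage ug
  (window_integrable hT Psi0 PsiL) hb euler.
split => //; exists (stieltjes_borel Psi); split; [split|split].
- exact: stieltjes_off_segment Psi0 PsiL.
- have nuJ := stieltjes_segment (ltW L0) Psi0 PsiL.
  by apply: le_lt_trans (ltry (Psi (T - 1))); rewrite -nuJ.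
- exact: (multiplier_support hT ug u_ge0 Psi0 PsiL slack).
exists N; split => // x /= /not_implyP[xT]; apply: contra_notP => xN.
by rewrite HN//; apply/esym; exact: (window_measure hT Psi0 PsiL x).
Qed.
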